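(* Let $r$ be a rational function with non-constant numerator, and let $D_1,\ldots,D_L$ be pairwise disjoint open disks around the distinct zeros $w_1,\ldots,w_L$ of $r$ (with $w_\ell\in D_\ell$), not containing poles of $r$, and such that $\bigcup_{\ell=1}^L\partial D_\ell$ does not contain poles of $r$ either. Let $$\rho=\min_{s\in\bigcup_{\ell=1}^L\partial D_\ell}|r(s)|$$ and assume that $$\Omega_0:=\{z\in\mathbb C:\ |r(z)|<\rho\}\subset\bigcup_{\ell=1}^L D_\ell .$$ Then every (complex-valued) function $f$ analytic in a neighborhood of $\bigcup_{\ell=1}^L\overline{D_\ell}$ can be written in a unique way as $$f(z)=Z_r(z)F(r(z)),\qquad z\in\Omega_0,$$ where $F$ is $\mathbb C^N$-valued and analytic in $|z|<\rho$.
   Context: Standing assumption: $r=p/q$ with $p,q$ coprime polynomials and $\deg p\ge\deg q$; $N=\deg p$ is the degree of $r$. The state space $\mathfrak L(r)$ is the linear span of the functions $z\mapsto\frac{r(z)-r(a)}{z-a}$, where $a$ runs through the points of analyticity of $r$; it has dimension $N$. A basis $e_1,\ldots,e_N$ of $\mathfrak L(r)$ is fixed and $Z_r(z)=\begin{pmatrix}e_1(z)&\cdots&e_N(z)\end{pmatrix}$ (a $1\times N$ row). *)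

(* Defs.v *)
From HB Require Import structures.
From mathcomp Require Import all_boot all_order all_algebra.
From mathcomp Require Import complex.
From mathcomp Require Import all_classical all_reals all_analysis.

Set Implicit Arguments.
Unset Strict Implicit.
Unset Printing Implicit Defensive.

Import Order.TTheory GRing.Theory Num.Theory.
Import numFieldNormedType.Exports.

Local Open Scope classical_set_scope.
Local Open Scope ring_scope.
Local Open Scope complex_scope.

(* The topology and the norm of a numeric field are attached to the structure
   rather than to the carrier R[i], hence this alias.  The norm on it takes its
   values in R[i] itself, so that radii x : R are compared with it as x%:C. *)
Definition cplx (R : realType) : numClosedFieldType := R[i].

Section Analytic.
Variables (R : realType) (V : normedModType (cplx R)).

(* Analyticity at a point is the existence of a power series expansion in
   some disk around it. *)
Definition analytic_at (f : cplx R -> V) (a : cplx R) : Prop :=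
  exists (c : nat -> V) (e : R), 0 < e /\
    forall z : cplx R, ball a (e%:C : cplx R) z ->
      series (fun n => (z - a) ^+ n *: c n) n @[n --> \oo] --> f z.

Definition analytic_on (A : set (cplx R)) (f : cplx R -> V) : Prop :=
  forall a, A a -> analytic_at f a.

Definition analytic_near (K : set (cplx R)) (f : cplx R -> V) : Prop :=
  exists U : set (cplx R), [/\ open U, K `<=` U & analytic_on U f].

End Analytic.

Definition frontier (T : topologicalType) (A : set T) : set T :=
  closure A `\` A°.

Section RationalFunction.
Variable R : realType.
Local Notation C := (cplx R).
Variables p q : {poly C}.

Definition ratfun (z : C) : C := p.[z] / q.[z].

(* For coprime p and q the poles of p / q are the roots of q.  At a pole
   [ratfun] has the junk value 0, so that every condition on the values of
   the rational function has to be restricted to this set. *)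
Definition regular : set C := [set z | q.[z] != 0].

(* z |-> (r(z) - r(a)) / (z - a) is a rational function which is analytic
   at z = a, with value r'(a). *)
Definition diffquot (a z : C) : C :=
  if z == a then derive1 ratfun a else (ratfun z - ratfun a) / (z - a).

(* Elements of the state space, and identities between them, only matter on
   the domain [regular] of r; their values at the poles are irrelevant. *)
Definition state_space : set (C -> C) :=
  [set g | exists (n : nat) (a b : 'I_n -> C),
    (forall i, regular (a i)) /\
    (forall z, regular z -> g z = \sum_(i < n) b i * diffquot (a i) z)].

Definition state_space_basis (N : nat) (e : 'I_N -> C -> C) : Prop :=
  [/\ forall i, state_space (e i),
      forall b : 'I_N -> C,
        (forall z, regular z -> \sum_(i < N) b i * e i z = 0) ->
        forall i, b i = 0
    & forall g, state_space g -> exists b : 'I_N -> C,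
        forall z, regular z -> g z = \sum_(i < N) b i * e i z].

Definition zero_set : set C := [set z | regular z /\ ratfun z = 0].

Definition sublevel (rho : R) : set C :=
  [set z | regular z /\ `|ratfun z| < (rho%:C : C)].

Definition is_min_modulus (S : set C) (rho : R) : Prop :=
  (exists2 s, S s & `|ratfun s| = (rho%:C : C)) /\
  (forall s, S s -> (rho%:C : C) <= `|ratfun s|).

End RationalFunction.

Definition Zrow (R : realType) (N : nat) (e : 'I_N -> cplx R -> cplx R)
    (z : cplx R) : 'rV[cplx R]_N :=
  \row_i e i z.

(* Main.v *)
Require Import Defs.
From HB Require Import structures.
From mathcomp Require Import all_boot all_order all_algebra.
From mathcomp Require Import complex ring lra separable.
From mathcomp Require Import all_classical all_reals all_analysis.

Set Implicit Arguments.
Unset Strict Implicit.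
Unset Printing Implicit Defensive.

Import Order.TTheory GRing.Theory Num.Theory.
Import numFieldNormedType.Exports.

Local Open Scope classical_set_scope.
Local Open Scope ring_scope.
Local Open Scope complex_scope.

(** Write [N] for the degree of [p] and [r] for [p / q].  The state space is
the set of all [u / q] with [u] a polynomial of degree less than [N].  For
fixed [s] the vector [F s] is therefore the same thing as a polynomial [v_s]
of degree less than [N], and [f z = Z z *m F (r z)] says that [q f] and [v_s]
agree on the fibre [r = s], that is, on the [N] roots of [p - s q]: [v_s]
interpolates [q f] there.  Analyticity of [F] is a local property, so the
theorem follows from three facts about a point [s0] with [|s0| < rho].

The fibre is full: [p - s0 q] has degree [N] ([size_fibre]).  Otherwise [s0]
would be the value of [r] at infinity, and the sublevel set would be
unbounded, whereas it lies in finitely many disks.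

Local existence ([local_solution]).  Newton division of [g] by
[p - s0 q = (r - s0) q] at its roots gives [g = u + (r - s0) q h] with
[deg u < N] and [h] again analytic near the roots.  Starting from [q f] and
dividing [q h] in the same way at each step, one obtains
[q f = u_0 + u_1 (r - s0) + u_2 (r - s0)^2 + ...].  For a suitable norm on
functions analytic in fixed disks around the roots ([expands]), a division step
is bounded, so that the [u_n] grow at most geometrically and the series
converges for [r] close to [s0] ([division_expansion]).  The points where [r]
is close to [s0] do lie in these disks ([fibre_covering]).  The coordinates of
the [u_n] in the given basis are the Taylor coefficients of [F] at [s0].

Uniqueness ([representation_unique]).  For all but finitely many [s] the fibre
consists of [N] distinct points ([generic_fibre]), and a polynomial of degree
less than [N] that vanishes at all of them is zero; the remaining values of
[s] follow by continuity.

By uniqueness the local solutions agree where they are both defined, so the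
function whose value at [s] is the value of the local solution around [s] is
analytic and represents [f]. *)

(** * The modulus of a complex number *)

Section Modulus.
Variable R : realType.
Local Notation C := (cplx R).
Implicit Types (x y z : C) (e : R).

(** The modulus with values in the totally ordered field [R]: the norm of [C]
  takes its values in [C] itself. *)
Definition cmod (x : C) : R := Normc.normc x.
Arguments cmod : simpl never.

Lemma cmodE x : `|x| = (cmod x)%:C.
Proof. by []. Qed.

Lemma cmod_ge0 x : 0 <= cmod x.
Proof. by rewrite -lecR -cmodE; exact: (normr_ge0 (x : C)). Qed.

Lemma cmodM x y : cmod (x * y) = cmod x * cmod y.
Proof. exact: Normc.normcM. Qed.

Lemma cmodD x y : cmod (x + y) <= cmod x + cmod y.
Proof. exact: le_normcD. Qed.

Lemma cmodN x : cmod (- x) = cmod x.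
Proof. exact: normcN. Qed.

Lemma cmodV x : cmod x^-1 = (cmod x)^-1.
Proof. exact: Normc.normcV. Qed.

Lemma cmod0 : cmod 0 = 0.
Proof. exact: Normc.normc0. Qed.

Lemma cmod1 : cmod 1 = 1.
Proof. exact: Normc.normc1. Qed.

Lemma cmod_eq0 x : (cmod x == 0) = (x == 0).
Proof.
by apply/eqP/eqP => [/Normc.eq0_normc|->]; rewrite ?cmod0.
Qed.

Lemma cmod_gt0 x : (0 < cmod x) = (x != 0).
Proof. by rewrite lt_def cmod_eq0 cmod_ge0 andbT. Qed.

Lemma cmodB x y : cmod (x - y) <= cmod x + cmod y.
Proof. by rewrite -(cmodN y); exact: cmodD. Qed.

Lemma cmodBC x y : cmod (x - y) = cmod (y - x).
Proof. by rewrite -cmodN opprB. Qed.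

Lemma cmodX x n : cmod (x ^+ n) = cmod x ^+ n.
Proof. by elim: n => [|n IH]; rewrite ?cmod1// !exprS cmodM IH. Qed.

Lemma cmod_real e : 0 <= e -> cmod (e%:C : C) = e.
Proof.
by move=> e0; rewrite /cmod /Normc.normc /= expr0n addr0 sqrtr_sqr ger0_norm.
Qed.

Lemma cmod_sum (I : Type) (r : seq I) (P : pred I) (F : I -> C) :
  cmod (\sum_(i <- r | P i) F i) <= \sum_(i <- r | P i) cmod (F i).
Proof.
elim/big_rec2: _ => [|i y x _ IH]; first by rewrite cmod0.
by apply: le_trans (cmodD _ _) _; rewrite lerD2l.
Qed.

Lemma cplx_gt0 (e : C) : 0 < e -> exists2 r : R, 0 < r & e = r%:C.
Proof.
move=> e0; exists (cmod e); first by rewrite cmod_gt0 gt_eqF.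
by rewrite -cmodE gtr0_norm.
Qed.

Lemma cplx_ballE (a z : C) e : ball a (e%:C : C) z <-> cmod (z - a) < e.
Proof. by rewrite -ball_normE /= cmodE cmodBC ltcR. Qed.

Lemma cvg_cmodP (u : nat -> C) (l : C) :
  u n @[n --> \oo] --> l <->
  forall e, 0 < e -> exists N, forall n, (N <= n)%N -> cmod (u n - l) < e.
Proof.
split=> [/cvgrPdist_lt h e e0|h].
  have [|N _ hN] := h (e%:C); first by rewrite ltcR.
  by exists N => n /hN /=; rewrite cmodBC cmodE ltcR.
apply/cvgrPdist_lt => _ /cplx_gt0 [e e0 ->]; have [N hN] := h e e0.
by exists N => // n /hN; rewrite /= cmodBC cmodE ltcR.
Qed.

Lemma cmod_lim_le (u : nat -> C) (l x : C) (B : R) (N : nat) :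
  u n @[n --> \oo] --> l ->
  (forall n, (N <= n)%N -> cmod (u n - x) <= B) -> cmod (l - x) <= B.
Proof.
move=> /cvg_cmodP h hB; apply/ler_addgt0Pr => e e0.
have [M hM] := h e e0; pose n := maxn N M.
have -> : l - x = (u n - x) - (u n - l) by ring.
apply: le_trans (cmodB _ _) _; apply: lerD.
  by apply: hB; rewrite leq_maxl.
by apply/ltW/hM; rewrite leq_maxr.
Qed.

(** The limit is assembled from those of the real and imaginary parts, by
  completeness of [R]. *)
Lemma cmod_cauchy_geometric (u : nat -> C) (K q : R) :
  0 <= q < 1 ->
  (forall k m, (k <= m)%N -> cmod (u m - u k) <= K * q ^+ k) ->
  exists l : C, u n @[n --> \oo] --> l.
Proof.
move=> /andP[q0 q1] h.
have K0 : 0 <= K.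
  by have := h 0%N 0%N (leqnn _); rewrite subrr cmod0 expr0 mulr1.
have small (e : R) : 0 < e ->
    exists N, forall k m, (N <= k)%N -> (k <= m)%N -> cmod (u m - u k) < e.
  move=> e0.
  have /cvgrPdist_lt/(_ e e0) [N _ hN] : geometric K q n @[n --> \oo] --> 0.
    by apply: cvg_geometric; rewrite ger0_norm.
  exists N => k m Nk km; apply: le_lt_trans (h _ _ km) _.
  have := hN k Nk; rewrite /= sub0r normrN ger0_norm ?mulr_ge0 ?exprn_ge0 //.
have Recmod z : `|complex.Re z : R| <= cmod z.
  by have := normc_ge_Re z; rewrite lecR.
have Imcmod z : `|complex.Im z : R| <= cmod z.
  case: z => a b; rewrite /cmod /Normc.normc /= -sqrtr_sqr ler_wsqrtr //.
  by rewrite lerDr sqr_ge0.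
have part (f : C -> R) : (forall x y, f (x - y) = f x - f y) ->
    (forall z, `|f z| <= cmod z) ->
    exists l : R, forall e, 0 < e ->
      exists N, forall n, (N <= n)%N -> `|f (u n) - l| < e.
  move=> fB fle.
  have /cauchy_cvgP cvgf : cauchy ((fun n => f (u n)) @ \oo).
    apply/cauchy_exP => e e0; have [N hN] := small e e0.
    exists (f (u N)); exists N => // n Nn; rewrite /= -ball_normE /=.
    by rewrite distrC -fB; apply: le_lt_trans (fle _) (hN _ _ _ _).
  exists (lim ((fun n => f (u n)) @ \oo)) => e e0.
  have /cvgrPdist_lt/(_ e e0) [N _ hN] := cvgf.
  by exists N => n /hN /=; rewrite distrC.
have [a ha] := part (@complex.Re R) ltac:(by case=> ? ? [? ?]) Recmod.
have [b hb] := part (@complex.Im R) ltac:(by case=> ? ? [? ?]) Imcmod.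
exists (a +i* b); apply/cvg_cmodP => e e0.
have e20 : 0 < e / 2 by rewrite divr_gt0.
have [Na hNa] := ha _ e20; have [Nb hNb] := hb _ e20.
exists (maxn Na Nb) => n; rewrite geq_max => /andP[/hNa + /hNb].
case: (u n) => x y /= hx hy.
rewrite -[ltLHS]/(cmod ((x - a) +i* (y - b))).
have -> : (x - a) +i* (y - b) = (x - a)%:C + (0 +i* (y - b)).
  by apply/eqP; rewrite eq_complex /= !addr0 !add0r !eqxx.
apply: le_lt_trans (cmodD _ _) _.
rewrite /cmod /Normc.normc /= !expr0n /= addr0 add0r !sqrtr_sqr.
by rewrite [ltRHS](splitr e) ltrD.
Qed.

End Modulus.
Arguments cmod : simpl never.

(** * Functions with controlled Taylor expansions *)

Section Expansion.
Variable R : realType.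
Local Notation C := (cplx R).
Implicit Types (a b z : C) (d M : R) (g h : C -> C).

(** Analyticity at [a] with a bound: [M] controls both the Taylor coefficients,
  rescaled to the disk of radius [d], and all Taylor remainders on this disk.
  With remainder estimates in place of convergence, the closure properties
  below are finite computations that follow the constant [M]. *)
Definition expands (a : C) (d M : R) (g : C -> C) : Prop :=
  exists gam : nat -> C, (forall n, cmod (gam n) * d ^+ n <= M) /\
    forall k z, cmod (z - a) < d ->
      cmod (g z - \sum_(n < k) gam n * (z - a) ^+ n)
        <= M * (cmod (z - a) / d) ^+ k.

Lemma expands_ge0 a d M g : expands a d M g -> 0 <= M.
Proof.
move=> [gam [h _]]; have := h 0%N; rewrite expr0 mulr1.
exact/le_trans/cmod_ge0.
Qed.

Lemma expands_le a d d' M M' g :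
  0 < d' -> d' <= d -> M <= M' -> expands a d M g -> expands a d' M' g.
Proof.
move=> d'0 dd MM ex; have M0 := expands_ge0 ex; case: ex => gam [h1 h2].
have d0 : 0 < d by exact: lt_le_trans dd.
exists gam; split=> [n|k z zd].
  apply: le_trans MM; apply: le_trans (h1 n).
  by rewrite ler_wpM2l ?cmod_ge0 // lerXn2r // nnegrE ltW.
apply: le_trans (h2 k z (lt_le_trans zd dd)) _.
apply: ler_pM => //; first by rewrite exprn_ge0 // divr_ge0 ?cmod_ge0 // ltW.
have tge0 e : 0 < e -> 0 <= cmod (z - a) / e.
  by move=> e0; rewrite divr_ge0 ?cmod_ge0 // ltW.
rewrite lerXn2r ?nnegrE ?tge0 //.
by rewrite ler_wpM2l ?cmod_ge0 // lef_pV2 ?posrE.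
Qed.

Lemma expands_ext a d M g h :
  (forall z, cmod (z - a) < d -> g z = h z) ->
  expands a d M g -> expands a d M h.
Proof.
by move=> gh [gam [h1 h2]]; exists gam; split=> // k z zd; rewrite -gh // h2.
Qed.

Lemma expands_bound a d M g z :
  expands a d M g -> cmod (z - a) < d -> cmod (g z) <= M.
Proof.
by move=> [gam [_ h]] /(h 0%N); rewrite big_ord0 subr0 expr0 mulr1.
Qed.

Lemma expands_lipschitz a d M g z : 0 < d ->
  expands a d M g -> cmod (z - a) < d ->
  cmod (g z - g a) <= M / d * cmod (z - a).
Proof.
move=> d0 [gam [_ h]] zd.
have := h 1%N a; rewrite subrr cmod0 big_ord1 !expr0 mul0r expr1 mulr0 mulr1.
move=> /(_ d0) h0; have /eqP : cmod (g a - gam 0%N) = 0.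
  by apply/eqP; rewrite eq_le cmod_ge0 andbT.
rewrite cmod_eq0 subr_eq0 => /eqP ->.
have := h 1%N z zd; rewrite big_ord1 expr0 mulr1 expr1.
by rewrite mulrA mulrAC.
Qed.

Lemma expands_cst a d (c : C) : 0 < d -> expands a d (cmod c) (fun=> c).
Proof.
move=> d0; exists (fun n => if n is 0 then c else 0); split=> [[|n]|[|k] z zd].
- by rewrite expr0 mulr1.
- by rewrite cmod0 mul0r cmod_ge0.
- by rewrite big_ord0 subr0 expr0 mulr1.
- rewrite big_ord_recl expr0 mulr1 big1 ?addr0 => [|i _]; last by rewrite mul0r.
  rewrite subrr cmod0 mulr_ge0 ?cmod_ge0 // exprn_ge0 // divr_ge0 ?cmod_ge0 //.
  exact: ltW.
Qed.

Lemma expandsD a d M M' g h : 0 < d ->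
  expands a d M g -> expands a d M' h ->
  expands a d (M + M') (fun z => g z + h z).
Proof.
move=> d0 [gam [g1 g2]] [eta [h1 h2]]; exists (fun n => gam n + eta n).
split=> [n|k z zd].
  apply: le_trans (lerD (g1 n) (h1 n)); rewrite -mulrDl.
  by rewrite ler_wpM2r ?cmodD // exprn_ge0 // ltW.
rewrite mulrDl; apply: le_trans (lerD (g2 k z zd) (h2 k z zd)).
under eq_bigr do rewrite mulrDl.
by rewrite big_split /= opprD addrACA cmodD.
Qed.

Lemma expandsZ a d M (c : C) g :
  expands a d M g -> expands a d (cmod c * M) (fun z => c * g z).
Proof.
move=> [gam [g1 g2]]; exists (fun n => c * gam n); split=> [n|k z zd].
  by rewrite cmodM -mulrA ler_wpM2l ?cmod_ge0.
under eq_bigr do rewrite -mulrA.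
by rewrite -mulr_sumr -mulrBr cmodM -mulrA ler_wpM2l ?cmod_ge0 ?g2.
Qed.

Definition shift (gam : nat -> C) (n : nat) : C :=
  if n is m.+1 then gam m else 0.

(** Multiplication by [y + c], on coefficients.  It serves both for products by
  [z - b = (z - a) + (a - b)] and, with the roles of [gam] and [eta] exchanged,
  for quotients by [z - b]. *)
Lemma sum_shift (gam eta : nat -> C) (c y : C) k :
  (forall n, eta n = shift gam n + c * gam n) ->
  \sum_(n < k) eta n * y ^+ n + shift gam k * y ^+ k
    = (y + c) * \sum_(n < k) gam n * y ^+ n.
Proof.
move=> E; elim: k => [|k IH]; first by rewrite !big_ord0 mul0r mulr0 addr0.
rewrite !big_ord_recr /= mulrDr -IH E exprS; ring.
Qed.

Lemma shift_le (gam : nat -> C) d M n : 0 < d -> 0 <= M ->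
  (forall n, cmod (gam n) * d ^+ n <= M) ->
  cmod (shift gam n) * d ^+ n <= d * M.
Proof.
move=> d0 M0 h; case: n => [|n] /=.
  by rewrite cmod0 mul0r mulr_ge0 ?(ltW d0).
by rewrite exprS mulrCA ler_wpM2l ?(ltW d0).
Qed.

Lemma shift_term_le (gam : nat -> C) d M k y : 0 < d -> 0 <= M ->
  (forall n, cmod (gam n) * d ^+ n <= M) ->
  cmod (shift gam k * y ^+ k) <= d * M * (cmod y / d) ^+ k.
Proof.
move=> d0 M0 h; rewrite cmodM cmodX.
have -> : cmod (shift gam k) * cmod y ^+ k
            = cmod (shift gam k) * d ^+ k * (cmod y / d) ^+ k.
  by rewrite -mulrA -exprMn mulrCA divff ?mulr1 ?gt_eqF.
by rewrite ler_wpM2r ?shift_le // exprn_ge0 // divr_ge0 ?cmod_ge0 ?(ltW d0).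
Qed.

Lemma expandsMsub a d M b g : 0 < d ->
  expands a d M g ->
  expands a d ((2 * d + cmod (a - b)) * M) (fun z => (z - b) * g z).
Proof.
move=> d0 ex; have M0 := expands_ge0 ex; case: ex => [gam [g1 g2]].
exists (fun n => shift gam n + (a - b) * gam n); split=> [n|k z zd].
  have h1 := shift_le n d0 M0 g1.
  have h2 : cmod ((a - b) * gam n) * d ^+ n <= cmod (a - b) * M.
    by rewrite cmodM -mulrA ler_wpM2l ?cmod_ge0.
  have h3 := ler_wpM2r (exprn_ge0 n (ltW d0))
    (cmodD (shift gam n) ((a - b) * gam n)).
  have dM := mulr_ge0 (ltW d0) M0.
  apply: le_trans h3 _; rewrite mulrDl; apply: le_trans (lerD h1 h2) _.
  by rewrite mulrDl lerD2r -mulrA; lra.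
have := @sum_shift gam _ (a - b) (z - a) k (fun=> erefl).
move/(canRL (addrK _)) => ->.
have -> : z - a + (a - b) = z - b by ring.
rewrite opprB addrA addrAC -mulrBr.
apply: le_trans (cmodD _ _) _.
have := shift_term_le k (z - a) d0 M0 g1.
have : cmod ((z - b) * (g z - \sum_(n < k) gam n * (z - a) ^+ n))
       <= (d + cmod (a - b)) * (M * (cmod (z - a) / d) ^+ k).
  rewrite cmodM; apply: ler_pM; rewrite ?cmod_ge0 ?g2 //.
  have -> : z - b = (z - a) + (a - b) by ring.
  by apply: le_trans (cmodD _ _) _; rewrite lerD2r ltW.
by move=> h1 h2; apply: le_trans (lerD h1 h2) _; rewrite le_eqVlt; apply/orP;
  left; apply/eqP; ring.
Qed.

Lemma far_sub a d b z : 2 * d <= cmod (a - b) -> cmod (z - a) < d ->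
  d <= cmod (z - b).
Proof.
move=> ab za; have -> : z - b = (a - b) - (a - z) by ring.
have := cmodD (a - b - (a - z)) (a - z); rewrite subrK (cmodBC a z); lra.
Qed.

(** The coefficients [eta] of the quotient solve a first-order recursion; since
  [|a - b|] is at least twice [d], it propagates the bound [M / d]. *)
Lemma expandsDsub a d M b g : 0 < d -> 2 * d <= cmod (a - b) ->
  expands a d M g ->
  expands a d (2 * M / d) (fun z => g z / (z - b)).
Proof.
move=> d0 ab ex; have M0 := expands_ge0 ex; case: ex => [gam [g1 g2]].
have ab0 : 0 < cmod (a - b) by lra.
have abn0 : a - b != 0 by rewrite -cmod_gt0.
pose eta := fix eta n :=
  if n is m.+1 then (gam n - eta m) / (a - b) else gam 0%N / (a - b).
have etaE n : gam n = shift eta n + (a - b) * eta n.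
  by case: n => [|n] /=; rewrite mulrC divfK // ?add0r // addrC subrK.
have Md0 : 0 <= M / d by rewrite divr_ge0 // ltW.
have eta_le n : cmod (eta n) * d ^+ n <= M / d.
  elim: n => [|n IH] /=.
    have := g1 0%N; rewrite !expr0 !mulr1 cmodM cmodV => h.
    apply: ler_pM; rewrite ?cmod_ge0 ?invr_ge0 ?cmod_ge0 //.
    by rewrite lef_pV2 ?posrE //; lra.
  rewrite cmodM cmodV mulrAC ler_pdivrMr //.
  have h := ler_wpM2r (exprn_ge0 n.+1 (ltW d0)) (cmodB (gam n.+1) (eta n)).
  apply: le_trans h _; rewrite mulrDl.
  have h : cmod (eta n) * d ^+ n.+1 <= M.
    rewrite exprS mulrCA; apply: le_trans (ler_wpM2l (ltW d0) IH) _.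
    by rewrite mulrCA divff ?mulr1 ?gt_eqF.
  have h' : 2 * M <= M / d * cmod (a - b).
    apply: le_trans (ler_wpM2l Md0 ab).
    by rewrite mulrCA -(mulrA M) mulVf ?mulr1 ?gt_eqF.
  by have := g1 n.+1; lra.
exists eta; split=> [n|k z zd].
  by apply: le_trans (eta_le n) _; rewrite -mulrA; lra.
have zb := far_sub ab zd.
have zbn0 : z - b != 0 by rewrite -cmod_gt0; lra.
have E := sum_shift (z - a) k etaE.
have -> : g z / (z - b) - \sum_(n < k) eta n * (z - a) ^+ n =
  ((g z - \sum_(n < k) gam n * (z - a) ^+ n)
     - shift eta k * (z - a) ^+ k) / (z - b).
  rewrite -addrA -opprD E (_ : z - a + (a - b) = z - b); last by ring.
  by rewrite mulrBl mulrAC divff ?mul1r.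
rewrite cmodM cmodV.
have h1 := g2 k z zd; have h2 := shift_term_le k (z - a) d0 Md0 eta_le.
have -> : 2 * M / d * (cmod (z - a) / d) ^+ k =
  (M * (cmod (z - a) / d) ^+ k + d * (M / d) * (cmod (z - a) / d) ^+ k) / d.
  by rewrite (mulrC d) divfK ?gt_eqF //; ring.
apply: ler_pM; rewrite ?cmod_ge0 ?invr_ge0 ?cmod_ge0 //.
  by apply: le_trans (cmodB _ _) _; exact: lerD.
by rewrite lef_pV2 ?posrE //; lra.
Qed.

(** Division of [g - g a] by [z - a] drops the first Taylor coefficient and
  shifts the others; the value [c] of the quotient at [a] is the coefficient of
  degree one.  The quotient is only prescribed on the disk, so that one function
  can be expanded at several centres. *)
Lemma expands_quotient a d M g : 0 < d -> expands a d M g ->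
  exists c : C, forall h,
    (forall z, cmod (z - a) < d ->
       h z = if z == a then c else (g z - g a) / (z - a)) ->
    expands a d (M / d) h.
Proof.
move=> d0 [gam [g1 g2]]; exists (gam 1%N) => h hE.
have M0 : 0 <= M / d.
  rewrite divr_ge0 ?(ltW d0) //; have := g1 0%N.
  by rewrite expr0 mulr1; apply/le_trans/cmod_ge0.
have gam_le n : cmod (gam n.+1) * d ^+ n <= M / d.
  by rewrite ler_pdivlMr // -mulrA -exprSr.
have gam0 : g a = gam 0%N.
  have := g2 1%N a; rewrite subrr cmod0 big_ord1 !expr0 mul0r expr1 mulr0 mulr1.
  move=> /(_ d0) h0; have /eqP : cmod (g a - gam 0%N) = 0.
    by apply/eqP; rewrite eq_le cmod_ge0 andbT.
  by rewrite cmod_eq0 subr_eq0 => /eqP.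
exists (fun n => gam n.+1); split=> // k z zd; rewrite hE //.
have [->|za] := eqVneq z a.
  rewrite subrr cmod0 mul0r; case: k => [|k].
    rewrite big_ord0 subr0 expr0 mulr1.
    by have := gam_le 0%N; rewrite expr0 mulr1.
  rewrite big_ord_recl expr0 mulr1 big1 ?addr0 => [|i _].
    by rewrite subrr cmod0 expr0n mulr0.
  by rewrite exprS mul0r mulr0.
have y0 : z - a != 0 by rewrite subr_eq0.
have := g2 k.+1 z zd; rewrite big_ord_recl expr0 mulr1 gam0 opprD addrA.
have -> : \sum_(i < k) gam (lift ord0 i) * (z - a) ^+ lift ord0 i
    = (z - a) * \sum_(n < k) gam n.+1 * (z - a) ^+ n.
  by rewrite mulr_sumr; apply: eq_bigr => i _; rewrite /= exprS mulrCA.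
move=> h1; have -> : (g z - gam 0%N) / (z - a) -
    \sum_(n < k) gam n.+1 * (z - a) ^+ n = (g z - gam 0%N -
    (z - a) * \sum_(n < k) gam n.+1 * (z - a) ^+ n) / (z - a).
  by rewrite [RHS]mulrBl (mulrAC (z - a)) divff ?mul1r.
rewrite cmodM cmodV ler_pdivrMr ?cmod_gt0 //.
apply: le_trans h1 _; rewrite exprS le_eqVlt; apply/orP; left; apply/eqP; ring.
Qed.

End Expansion.

(** * Iterated Newton division *)

Section Division.
Variable R : realType.
Local Notation C := (cplx R).
Implicit Types (a b z : C) (d M : R) (g h : C -> C) (A : seq C).

Definition expands_on A d M g : Prop := forall a, a \in A -> expands a d M g.

(** Around each point of [A], the disk of radius [d] then stays at distance at
  least [d] from all other points of [A]. *)
Definition well_separated A d : Prop :=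
  {in A &, forall a b, a != b -> 2 * d <= cmod (a - b)}.

Lemma expands_on_poly A d (q : {poly C}) : 0 < d ->
  exists2 K, 0 <= K & forall M g, expands_on A d M g ->
    expands_on A d (K * M) (fun z => q.[z] * g z).
Proof.
move=> d0; elim: A => [|a A [K K0 IH]]; first by exists 0.
have [K' K'0 aK] : exists2 K', 0 <= K' & forall M g, expands a d M g ->
    expands a d (K' * M) (fun z => q.[z] * g z).
  elim/poly_ind: q {IH} => [|q c [K' K'0 IH]].
    exists 0 => // M g ex; rewrite mul0r -(cmod0 R).
    apply: expands_ext (expands_cst a 0 d0) => z _.
    by rewrite horner0 mul0r.
  exists ((2 * d + cmod (a - 0)) * K' + cmod c).
    by rewrite addr_ge0 ?cmod_ge0 // mulr_ge0 // addr_ge0 ?cmod_ge0 //; lra.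
  move=> M g ex; rewrite mulrDl -mulrA.
  apply: expands_ext
    (expandsD d0 (expandsMsub 0 d0 (IH _ _ ex)) (expandsZ c ex)) => z _.
  by rewrite hornerMXaddC subr0 mulrDl mulrCA !mulrA.
exists (K + K'); first exact: addr_ge0.
move=> M g ex x; rewrite in_cons => xA.
have M0 : 0 <= M by apply: (expands_ge0 (ex a _)); rewrite mem_head.
case/orP: xA => [/eqP ->|xA].
  apply: expands_le (aK _ _ (ex _ (mem_head _ _))) => //.
  by rewrite ler_wpM2r // lerDr.
apply: (@expands_le _ _ d _ (K * M)) => //.
  by rewrite ler_wpM2r // lerDl.
by apply: IH => // y yA; apply: ex; rewrite in_cons yA orbT.
Qed.

(** On the disk around [b] the quotient is a shift of Taylor coefficients; on
  the other disks [z - b] stays away from zero. *)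
Lemma divided_difference A d b : 0 < d -> well_separated A d -> b \in A ->
  forall M g, expands_on A d M g ->
  exists2 h, expands_on A d (4 / d * M) h &
    forall a z, a \in A -> cmod (z - a) < d -> g z = g b + (z - b) * h z.
Proof.
move=> d0 sep bA M g ex; have [c hc] := expands_quotient d0 (ex b bA).
have M0 := expands_ge0 (ex b bA).
have Md0 : 0 <= M / d by rewrite divr_ge0 // (ltW d0).
pose h z := if z == b then c else (g z - g b) / (z - b).
exists h => [a aA|a z aA zd]; last first.
  rewrite /h; have [->|zb] := eqVneq z b; first by rewrite subrr mul0r addr0.
  by rewrite mulrC divfK ?subr_eq0 // addrC subrK.
have [->|ab] := eqVneq a b.
  apply: (@expands_le _ _ d _ (M / d)) => //; last exact: hc.
  by rewrite mulrAC -mulrA; lra.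
have abd := sep a b aA bA ab.
have gb : cmod (- g b) <= M.
  by rewrite cmodN; apply: expands_bound (ex b bA) _; rewrite subrr cmod0.
have := expandsDsub d0 abd (expandsD d0 (ex a aA) (expands_cst a (- g b) d0)).
move=> e1; have {e1} := expands_ext _ e1; move=> /(_ h) e1.
apply: expands_le (e1 _) => //; last first.
  move=> z zd; rewrite /h; case: eqP => // zb.
  by have := far_sub abd zd; rewrite zb subrr cmod0 leNgt d0.
rewrite [leRHS]mulrAC ler_wpM2r ?invr_ge0 ?(ltW d0) //; lra.
Qed.

(** One divided difference for each root: [g = g b + (z - b) h], and then the
  same for [h] at the next root.  A divided difference belongs to the same class
  of functions as [g], so the list [rs] may have repetitions. *)
Lemma newton_division A d rs : 0 < d -> well_separated A d ->
  {subset rs <= A} ->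
  exists2 K, 0 <= K & forall M g, 0 <= M -> expands_on A d M g ->
    exists (u : {poly C}) h, [/\ (size u <= size rs)%N,
      forall i, cmod u`_i <= K * M, expands_on A d (K * M) h &
      forall a z, a \in A -> cmod (z - a) < d ->
        g z = u.[z] + (\prod_(b <- rs) ('X - b%:P)).[z] * h z].
Proof.
move=> d0 sep; elim: rs => [|b rs IH] sub.
  exists 1 => // M g M0 ex; exists 0, g; split.
  - by rewrite size_poly0.
  - move=> i; rewrite coef0 cmod0 mul1r.
    exact: M0.
  - by move=> a; rewrite mul1r; exact: ex.
  - by move=> a z _ _; rewrite horner0 add0r big_nil hornerC mul1r.
have bA : b \in A by apply: sub; rewrite mem_head.
have [|K K0 {}IH] := IH.
  by move=> x xr; apply: sub; rewrite in_cons xr orbT.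
have K1ge0 : 0 <= K * (4 / d) * (1 + cmod b).
  by rewrite !mulr_ge0 ?invr_ge0 ?(ltW d0) // addr_ge0 // cmod_ge0.
exists (K * (4 / d) * (1 + cmod b) + 1) => [|M g M0 ex].
  by rewrite addr_ge0.
have M1 : 0 <= 4 / d * M by rewrite !mulr_ge0 ?invr_ge0 ?(ltW d0).
have [g1 ex1 eq1] := divided_difference d0 sep bA ex.
have [u [h [su cu exh eqh]]] := IH _ _ M1 ex1.
exists (u * ('X - b%:P) + (g b)%:P), h; split.
- rewrite (leq_trans (size_polyD _ _)) // geq_max.
  rewrite (leq_trans (size_polyC_leq1 _)) //.
  rewrite andbT; have [->|u0] := eqVneq u 0; first by rewrite mul0r size_poly0.
  by rewrite size_Mmonic ?monicXsubC // size_XsubC addn2.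
- have gb : cmod (g b) <= M.
    by apply: expands_bound (ex b bA) _; rewrite subrr cmod0.
  pose B := K * (4 / d * M).
  have B0 : 0 <= B by apply: le_trans (cmod_ge0 u`_0) (cu _).
  have h1 i : cmod (if i == 0%N then 0 else u`_i.-1) <= B.
    by case: eqP => _; rewrite ?cmod0 ?cu.
  have h2 i : cmod (u`_i * b) <= B * cmod b.
    by rewrite cmodM ler_wpM2r ?cmod_ge0 // cu.
  have h3 i : cmod (if i == 0%N then g b else 0) <= M.
    by case: eqP => _; rewrite ?cmod0.
  move=> i; rewrite coefD mulrBr coefB coefMX coefMC coefC.
  apply: le_trans (cmodD _ _) _.
  apply: le_trans (lerD (cmodB _ _) (lexx _)) _.
  apply: le_trans (lerD (lerD (h1 i) (h2 i)) (h3 i)) _.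
  by rewrite /B le_eqVlt; apply/orP; left; apply/eqP; ring.
- move=> a aA; apply: expands_le (exh a aA) => //.
  rewrite mulrA ler_wpM2r // mulrDr mulr1 -addrA lerDl addr_ge0 //.
  by rewrite !mulr_ge0 ?invr_ge0 ?(ltW d0) ?cmod_ge0.
- move=> a z aA zd; rewrite (eq1 a z aA zd) (eqh a z aA zd) big_cons.
  by rewrite !(hornerE, hornerM, hornerXsubC) /=; ring.
Qed.

(** Newton division by the polynomial [P] with roots [rs], rewritten with
  [P = (P / q) q]: the factor [q] goes into the remainder, so that the step can
  be repeated with the powers of [P / q]. *)
Lemma division_step A d rs (lc : C) (q : {poly C}) : 0 < d ->
  well_separated A d ->
  {subset rs <= A} -> lc != 0 ->
  exists2 K, 1 <= K & forall M g, 0 <= M -> expands_on A d M g ->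
    exists (u : {poly C}) h, [/\ (size u <= size rs)%N,
      forall i, cmod u`_i <= K * M, expands_on A d (K * M) h &
      forall a z, a \in A -> cmod (z - a) < d -> q.[z] != 0 ->
        g z = u.[z]
          + (lc *: \prod_(b <- rs) ('X - b%:P)).[z] / q.[z] * h z].
Proof.
move=> d0 sep sub lc0.
have [K K0 hK] := newton_division d0 sep sub.
have [K' K'0 hK'] := expands_on_poly A (lc^-1 *: q) d0.
have KK0 : 0 <= K' * K by exact: mulr_ge0.
exists (1 + K + K' * K) => [|M g M0 ex]; first by lra.
have [u [h [su cu exh eqh]]] := hK _ _ M0 ex.
have KM0 : 0 <= K * M by exact: mulr_ge0.
have KKM0 : 0 <= K' * K * M by exact: mulr_ge0.
exists u, (fun z => (lc^-1 *: q).[z] * h z); split=> //.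
- by move=> i; apply: le_trans (cu i) _; rewrite !mulrDl; lra.
- move=> a aA; apply: expands_le (hK' _ _ exh a aA) => //.
  by rewrite !mulrDl mulrA; lra.
- move=> a z aA zd qz; rewrite (eqh a z aA zd) !hornerZ; congr (_ + _).
  by field; rewrite lc0 qz.
Qed.

(** The remainder after [k] steps is the [k]-th power of [P / q] times a
  function of size [M * K ^+ k]. *)
Lemma division_expansion A d rs (lc : C) (q : {poly C}) : 0 < d ->
  well_separated A d -> {subset rs <= A} -> lc != 0 ->
  exists2 K, 1 <= K & forall M g, 0 <= M -> expands_on A d M g ->
    exists u : nat -> {poly C}, [/\ forall n, (size (u n) <= size rs)%N,
      forall n i, cmod (u n)`_i <= K * M * K ^+ n &
      forall a z k, a \in A -> cmod (z - a) < d -> q.[z] != 0 ->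
        let s := (lc *: \prod_(b <- rs) ('X - b%:P)).[z] / q.[z] in
        cmod (g z - \sum_(n < k) (u n).[z] * s ^+ n)
          <= M * (K * cmod s) ^+ k].
Proof.
move=> d0 sep sub lc0; have [K K1 hK] := division_step q d0 sep sub lc0.
exists K => // M g M0 ex; have K0 : 0 <= K by lra.
(* Bounds and functions are iterated together: step [n] starts from a function
   of size [M * K ^+ n]. *)
have /choice [st hst] : forall x : R * (C -> C), exists y : {poly C} * (C -> C),
    0 <= x.1 -> expands_on A d x.1 x.2 ->
    [/\ (size y.1 <= size rs)%N,
      forall i, cmod y.1`_i <= K * x.1, expands_on A d (K * x.1) y.2 &
      forall a z, a \in A -> cmod (z - a) < d -> q.[z] != 0 ->
        x.2 z = y.1.[z]
          + (lc *: \prod_(b <- rs) ('X - b%:P)).[z] / q.[z] * y.2 z].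
  move=> [B f] /=.
  have [[B0 exf]|nex] := pselect (0 <= B /\ expands_on A d B f).
    by have [u [h huh]] := hK _ _ B0 exf; exists (u, h).
  by exists (0, f) => B0 exf; case: nex.
pose x n := iter n (fun y => (K * y.1, (st y).2)) (M, g).
have x1 n : (x n).1 = M * K ^+ n.
  elim: n => [|n IH]; first by rewrite expr0 mulr1.
  by rewrite /= -/(x n) IH exprS mulrCA.
have x1ge0 n : 0 <= (x n).1 by rewrite x1 mulr_ge0 // exprn_ge0.
have exx n : expands_on A d (x n).1 (x n).2.
  elim: n => [//|n IH]; rewrite /= -/(x n).
  by have [_ _ h _] := hst _ (x1ge0 n) IH.
exists (fun n => (st (x n)).1); split=> [n|n i|a z k aA zd qz /=].
- by have [] := hst _ (x1ge0 n) (exx n).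
- by have [_ + _ _] := hst _ (x1ge0 n) (exx n) => /(_ i); rewrite x1 mulrA.
set s := _ / q.[z].
have -> : g z - \sum_(n < k) (st (x n)).1.[z] * s ^+ n = s ^+ k * (x k).2 z.
  elim: k => [|k IH]; first by rewrite big_ord0 subr0 expr0 mul1r.
  rewrite big_ord_recr /= opprD addrA IH -/(x k).
  have [_ _ _ /(_ a z aA zd qz) ->] := hst _ (x1ge0 k) (exx k).
  by rewrite -/s exprSr; ring.
rewrite cmodM cmodX exprMn mulrA mulrC -x1 ler_wpM2r ?exprn_ge0 ?cmod_ge0 //.
exact: expands_bound (exx k a aA) zd.
Qed.

End Division.

(** * Power series and analytic functions *)

Section PowerSeries.
Variable R : realType.
Local Notation C := (cplx R).

Lemma le0_geometric (x B : R) : (forall m, x <= B * 2^-1 ^+ m) -> x <= 0.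
Proof.
move=> h; rewrite leNgt; apply/negP => x0.
have /cvgrPdist_lt/(_ x x0) [m _ hm] :
    geometric B (2^-1 : R) n @[n --> \oo] --> 0.
  by apply: cvg_geometric; rewrite ger0_norm; lra.
have := hm m (leqnn m); rewrite /= sub0r normrN => hx.
by have := le_lt_trans (le_trans (h m) (ler_norm _)) hx; rewrite ltxx.
Qed.

Lemma cvg_cmodB (u v : nat -> C) (l m : C) :
  u n @[n --> \oo] --> l -> v n @[n --> \oo] --> m ->
  (u n - v n) @[n --> \oo] --> l - m.
Proof.
move=> /cvg_cmodP hu /cvg_cmodP hv; apply/cvg_cmodP => e e0.
have e20 : 0 < e / 2 by rewrite divr_gt0.
have [N hN] := hu _ e20; have [N' hN'] := hv _ e20.
exists (maxn N N') => n; rewrite geq_max => /andP[/hN h1 /hN' h2].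
have -> : u n - v n - (l - m) = (u n - l) - (v n - m) by ring.
by apply: le_lt_trans (cmodB _ _) _; lra.
Qed.

Lemma geometric_tail (u : nat -> C) (B x : R) k j :
  0 <= x <= 1 -> (forall n, cmod (u n) <= B * (2^-1 * x) ^+ n) ->
  cmod (\sum_(n < k + j) u n - \sum_(n < k) u n) <= 2 * B * x ^+ k.
Proof.
move=> /andP[x0 x1] h.
have B0 : 0 <= B.
  by have := h 0%N; rewrite expr0 mulr1; apply/le_trans/cmod_ge0.
have Bxk : 0 <= B * x ^+ k by rewrite mulr_ge0 // exprn_ge0.
have pow_ge0 i : 0 <= 2^-1 ^+ i :> R by rewrite exprn_ge0 // invr_ge0.
suff : cmod (\sum_(n < k + j) u n - \sum_(n < k) u n)
         <= 2 * (B * x ^+ k) * (1 - 2^-1 ^+ j).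
  move=> hj; apply: le_trans hj _; rewrite -[2 * B * _]mulrA.
  by rewrite ler_piMr ?lerBlDr ?lerDl //; lra.
elim: j => [|j IH]; first by rewrite addn0 subrr cmod0 expr0 subrr mulr0.
rewrite addnS big_ord_recr /= addrAC.
apply: le_trans (cmodD _ _) _; apply: le_trans (lerD IH (h _)) _.
have : B * (2^-1 * x) ^+ (k + j) <= B * x ^+ k * 2^-1 ^+ j.
  rewrite exprMn !exprD.
  have -> : B * (2^-1 ^+ k * 2^-1 ^+ j * (x ^+ k * x ^+ j)) =
     (B * x ^+ k * 2^-1 ^+ j) * (2^-1 ^+ k * x ^+ j) by ring.
  rewrite ler_piMr ?mulr_ge0 ?exprn_ge0 ?invr_ge0 // mulr_ile1 ?exprn_ge0 //.
    by rewrite exprn_ile1 ?invr_ge0 // invf_le1 // ler1n.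
  by rewrite exprn_ile1.
rewrite (exprSr 2^-1); set p := 2^-1 ^+ j; set y := B * x ^+ k; nra.
Qed.

Lemma cvg_partial_sums (u : nat -> C) (B : R) :
  (forall n, cmod (u n) <= B * (4^-1) ^+ n) ->
  exists l : C, (\sum_(n < m) u n) @[m --> \oo] --> l.
Proof.
move=> h; apply: (@cmod_cauchy_geometric _ _ (2 * B) 2^-1); first by lra.
move=> k m km; rewrite -(subnKC km); apply: geometric_tail; first by lra.
by move=> n; apply: le_trans (h n) _; rewrite -invfM -natrM.
Qed.

(** The bound [n r^(n-1) |x - y|] is weakened to a geometric one, which can be
  summed against geometrically bounded coefficients. *)
Lemma cmod_expB (x y : C) (r : R) n : 0 < r -> cmod x <= r -> cmod y <= r ->
  cmod (x ^+ n - y ^+ n) <= (2 * r) ^+ n / r * cmod (x - y).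
Proof.
move=> r0 xr yr; elim: n => [|n IH].
  by rewrite !expr0 subrr cmod0 mulr_ge0 ?cmod_ge0 // mul1r invr_ge0 ltW.
have -> : x ^+ n.+1 - y ^+ n.+1 = x * (x ^+ n - y ^+ n) + y ^+ n * (x - y).
  by rewrite !exprS; ring.
apply: le_trans (cmodD _ _) _; rewrite !cmodM cmodX.
have h1 := ler_pM (cmod_ge0 _) (cmod_ge0 _) xr IH.
have h2 : cmod y ^+ n <= (2 * r) ^+ n.
  rewrite lerXn2r ?nnegrE ?cmod_ge0 ?mulr_ge0 ?(ltW r0) //; lra.
have h3 := ler_wpM2r (cmod_ge0 (x - y)) h2.
apply: le_trans (lerD h1 h3) _; rewrite le_eqVlt; apply/orP; left; apply/eqP.
by rewrite (exprS (2 * r)); field; rewrite gt_eqF.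
Qed.

(** At distance at most a quarter of [1 / K] the terms are bounded by powers of
  one fourth, and the partial sums are Lipschitz with a common constant. *)
Lemma power_series (c : nat -> C) (B K : R) (s0 : C) : 0 < K ->
  (forall n, cmod (c n) <= B * K ^+ n) ->
  exists Phi : C -> C,
    (forall s, cmod (s - s0) <= (4 * K)^-1 ->
      (\sum_(n < m) c n * (s - s0) ^+ n) @[m --> \oo] --> Phi s) /\
    (forall s m, cmod (s - s0) <= (4 * K)^-1 ->
      cmod (Phi s - \sum_(n < m) c n * (s - s0) ^+ n) <= 2 * B * 2^-1 ^+ m) /\
    (forall s t, cmod (s - s0) <= (4 * K)^-1 -> cmod (t - s0) <= (4 * K)^-1 ->
      cmod (Phi s - Phi t) <= 8 * B * K * cmod (s - t)).
Proof.
move=> K0 hc; set r := (4 * K)^-1.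
have r0 : 0 < r by rewrite invr_gt0 mulr_gt0.
have B0 : 0 <= B.
  by have := hc 0%N; rewrite expr0 mulr1; apply/le_trans/cmod_ge0.
have Kr : K * r = 4^-1 by rewrite /r; field; rewrite gt_eqF.
have term_le s : cmod (s - s0) <= r ->
    forall n, cmod (c n * (s - s0) ^+ n) <= B * 4^-1 ^+ n.
  move=> sr n; rewrite cmodM cmodX -Kr exprMn mulrA.
  apply: ler_pM; rewrite ?cmod_ge0 ?exprn_ge0 ?cmod_ge0 //.
  by rewrite lerXn2r ?nnegrE ?cmod_ge0 ?(ltW r0).
have /choice [Phi hPhi] : forall s : C, exists l : C, cmod (s - s0) <= r ->
    (\sum_(n < m) c n * (s - s0) ^+ n) @[m --> \oo] --> l.
  move=> s; have [sr|] := boolP (cmod (s - s0) <= r); last by exists 0.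
  have [l hl] := cvg_partial_sums (term_le s sr).
  by exists l.
exists Phi; split=> //; split=> [s m sr|s t sr tr].
  refine (cmod_lim_le (N := m) (hPhi s sr) _) => j mj; rewrite -(subnKC mj).
  have := @geometric_tail (fun n => c n * (s - s0) ^+ n) B 2^-1 m (j - m).
  apply; first by lra.
  by move=> n; apply: le_trans (term_le s sr n) _; rewrite -invfM -natrM.
have hs := hPhi s sr; have ht := hPhi t tr.
have hst := cvg_cmodB hs ht.
have := @cmod_lim_le R _ _ 0 (8 * B * K * cmod (s - t)) 0 hst.
rewrite subr0; apply => m _; rewrite subr0 -sumrB.
have := @geometric_tail (fun n => c n * (s - s0) ^+ n - c n * (t - s0) ^+ n)
  (B / r * cmod (s - t)) 1 0 m.
rewrite add0n big_ord0 subr0 expr0 mulr1.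
have -> : 8 * B * K * cmod (s - t) = 2 * (B / r * cmod (s - t)).
  by rewrite /r; field; rewrite gt_eqF.
apply; first by rewrite ler01 lexx.
move=> n; rewrite mulr1 -mulrBr cmodM.
have := cmod_expB n r0 sr tr.
have -> : s - s0 - (t - s0) = s - t by ring.
move=> h; have := ler_pM (cmod_ge0 _) (cmod_ge0 _) (hc n) h.
move=> h'; apply: le_trans h' _; rewrite le_eqVlt; apply/orP; left; apply/eqP.
have -> : 2^-1 = K * (2 * r) :> R by rewrite mulrCA Kr; field.
by rewrite !exprMn; ring.
Qed.

(** The terms of the expansion are bounded at distance [e / 2] from [a]; with
  [d = e / 4] they are therefore dominated by powers of one half on the disk of
  radius [d]. *)
Lemma analytic_expands (f : C -> C) (a : C) : analytic_at f a ->
  exists d M : R, 0 < d /\ expands a d M f.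
Proof.
move=> [c [e [e0 h]]].
have e20 : 0 < e / 2 by rewrite divr_gt0.
have hz z : cmod (z - a) < e ->
    (\sum_(n < m) c n * (z - a) ^+ n) @[m --> \oo] --> f z.
  move=> ze; have /h : ball a (e%:C : C) z by apply/cplx_ballE.
  apply: cvg_trans; apply: near_eq_cvg; near=> m.
  by rewrite seriesEord /=; apply: eq_bigr => i _; rewrite mulrC.
have [B hB] : exists B, forall n, cmod (c n) * (e / 2) ^+ n <= B.
  pose z0 : C := a + (e / 2)%:C.
  have z0a : z0 - a = (e / 2)%:C by rewrite /z0 addrAC subrr add0r.
  have cz0 : cmod (z0 - a) = e / 2 by rewrite z0a cmod_real // ltW.
  have /hz/cvg_cmodP/(_ 1 ltr01) [N hN] : cmod (z0 - a) < e by rewrite cz0; lra.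
  exists (2 + \sum_(n < N) cmod (c n) * (e / 2) ^+ n) => n.
  have term0 i : 0 <= cmod (c i) * (e / 2) ^+ i.
    by rewrite mulr_ge0 ?cmod_ge0 // exprn_ge0 // ltW.
  have sum0 : 0 <= \sum_(n < N) cmod (c n) * (e / 2) ^+ n.
    exact: sumr_ge0.
  have [nN|Nn] := ltnP n N.
    rewrite (bigD1 (Ordinal nN)) //= addrCA lerDl addr_ge0 //.
    exact: sumr_ge0.
  have /= h1 := hN n Nn; have /= h2 := hN n.+1 (leqW Nn).
  have E : c n * (z0 - a) ^+ n = (\sum_(i < n.+1) c i * (z0 - a) ^+ i - f z0)
      - (\sum_(i < n) c i * (z0 - a) ^+ i - f z0).
    by rewrite big_ord_recr /=; ring.
  rewrite -cz0 -cmodX -cmodM E; apply: le_trans (cmodB _ _) _; rewrite cz0; lra.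
have B0 : 0 <= B.
  by have := hB 0%N; rewrite expr0 mulr1; apply/le_trans/cmod_ge0.
exists (e / 4), (2 * B); split; first by rewrite divr_gt0.
exists c; split=> [n|k z zd].
  have h2 : (e / 4) ^+ n <= (e / 2) ^+ n.
    by rewrite lerXn2r ?nnegrE; lra.
  have := ler_wpM2l (cmod_ge0 (c n)) h2; have := hB n; lra.
have x01 : 0 <= cmod (z - a) / (e / 4) <= 1.
  rewrite divr_ge0 ?cmod_ge0 //=; last by lra.
  by rewrite ler_pdivrMr ?mul1r ?ltW // divr_gt0.
have /hz zc : cmod (z - a) < e by lra.
refine (cmod_lim_le (N := k) zc _) => m km; rewrite -(subnKC km).
have := @geometric_tail (fun n => c n * (z - a) ^+ n) B _ k (m - k) x01.
apply=> n; rewrite cmodM cmodX.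
have -> : 2^-1 * (cmod (z - a) / (e / 4)) = cmod (z - a) / (e / 2).
  by field; rewrite gt_eqF.
rewrite expr_div_n mulrCA mulrA -ler_pdivrMr ?invr_gt0 ?exprn_gt0 // invrK.
by rewrite mulrAC mulrC ler_wpM2l ?exprn_ge0 ?cmod_ge0.
Unshelve. all: by end_near.
Qed.

(** Neighbourhoods of a matrix are products of neighbourhoods of its entries. *)
Lemma cvg_col N (u : nat -> 'cV[C]_N) (v : 'cV[C]_N) :
  (forall i, u n i 0 @[n --> \oo] --> v i 0) -> u n @[n --> \oo] --> v.
Proof.
move=> h A [P hP PA]; apply: filterS PA _.
have : \forall n \near \oo,
    forall ij : 'I_N * 'I_1, P ij.1 ij.2 (u n ij.1 ij.2).
  apply: filter_forall => -[i j] /=; rewrite (ord1 j).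
  exact: h (hP i 0).
by apply: filterS => n hn i j; exact: hn (i, j).
Qed.

Lemma analytic_col N (F : C -> 'cV[C]_N) (c : 'I_N -> nat -> C) (s0 : C)
    (e : R) : 0 < e ->
  (forall i s, cmod (s - s0) < e ->
    (\sum_(n < m) c i n * (s - s0) ^+ n) @[m --> \oo] --> F s i 0) ->
  analytic_at F s0.
Proof.
move=> e0 h; exists (fun n => \col_i c i n), e; split=> // s /cplx_ballE se.
apply: cvg_col => i; apply: cvg_trans (h i s se); apply: near_eq_cvg.
near=> m; rewrite seriesEord summxE; apply: eq_bigr => j _.
by rewrite !mxE mulrC.
Unshelve. all: by end_near.
Qed.

Lemma analytic_coord N (F : C -> 'cV[C]_N) (a : C) i :
  analytic_at F a -> analytic_at (fun s => F s i 0) a.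
Proof.
move=> [c [e [e0 h]]]; exists (fun n => c n i 0), e; split=> // z /h hz.
have := cvg_comp _ _ hz (@coord_continuous C N 1 i 0 (F z)).
apply: cvg_trans; apply: near_eq_cvg; near=> m.
by rewrite /= !seriesEord summxE; apply: eq_bigr => j _; rewrite mxE.
Unshelve. all: by end_near.
Qed.

End PowerSeries.

(** * Polynomials *)

Section Polynomials.
Variable R : realType.
Local Notation C := (cplx R).
Implicit Types (P Q p q : {poly C}) (a b z s : C).

Lemma poly_factor P : exists (lc : C) (rs : seq C),
  [/\ P = lc *: \prod_(b <- rs) ('X - b%:P), P != 0 -> lc != 0,
      P != 0 -> size P = (size rs).+1 &
      P != 0 -> forall b, (b \in rs) = root P b].
Proof.
have [rs E] := closed_field_poly_normal P.
exists (lead_coef P), rs; split=> //; rewrite -lead_coef_eq0 //.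
  by move=> l0; rewrite {1}E size_scale // size_prod_XsubC.
by move=> l0 b; rewrite {1}E rootZ // root_prod_XsubC.
Qed.

(** Induction on the roots: [P = P(b) + (z - b) P1], where [P1] is dominated by
  the product of the other factors, and so is the constant [P(b)] because each
  factor has modulus at least [d]. *)
Lemma poly_le_prod (d : R) (rs : seq C) P : 0 < d ->
  (size P <= (size rs).+1)%N ->
  exists2 K : R, 0 <= K & forall z, (forall b, b \in rs -> d <= cmod (z - b)) ->
    cmod P.[z] <= K * cmod (\prod_(b <- rs) ('X - b%:P)).[z].
Proof.
move=> d0; elim: rs P => [|b rs IH] P sP.
  have [c ->] : exists c, P = c%:P by exists P`_0; exact: size1_polyC.
  exists (cmod c) => [|z _]; first exact: cmod_ge0.
  by rewrite big_nil !hornerC cmod1 mulr1.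
have /factor_theorem [P1 E] : root (P - P.[b]%:P) b.
  by rewrite rootE !hornerE subrr.
have sP1 : (size P1 <= (size rs).+1)%N.
  have [->|P10] := eqVneq P1 0; first by rewrite size_poly0.
  have : (size (P - P.[b]%:P)%R <= (size rs).+2)%N.
    rewrite (leq_trans (size_polyD _ _)) // geq_max sP size_polyN.
    by rewrite (leq_trans (size_polyC_leq1 _)).
  by rewrite E size_Mmonic ?monicXsubC // size_XsubC addn2.
have [K1 K10 h1] := IH P1 sP1.
have [|K2 K20 h2] := IH (P.[b]%:P).
  by rewrite (leq_trans (size_polyC_leq1 _)).
exists (K1 + K2 / d) => [|z hz].
  by rewrite addr_ge0 // divr_ge0 // ltW.
have hz' c : c \in rs -> d <= cmod (z - c).
  by move=> crs; apply: hz; rewrite in_cons crs orbT.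
have -> : P.[z] = P1.[z] * (z - b) + P.[b].
  by rewrite -{1}(subrK (P.[b]%:P) P) E !hornerE.
have := h1 z hz'; have := h2 z hz'; have zb := hz b (mem_head _ _).
rewrite hornerC big_cons hornerM hornerXsubC !cmodM.
set y := cmod (\prod_(_ <- _) _).[z] => h3 h4.
have y0 : 0 <= y by exact: cmod_ge0.
apply: le_trans (cmodD _ _) _; rewrite cmodM mulrDl; apply: lerD.
  by rewrite mulrC mulrCA; apply: ler_wpM2l => //; exact: cmod_ge0.
apply: le_trans h3 _; rewrite -mulrA ler_wpM2l // mulrA ler_peMl //.
by rewrite mulrC ler_pdivlMr // mul1r.
Qed.

Lemma poly_dominated (d : R) P Q : 0 < d -> Q != 0 ->
  (size P <= size Q)%N ->
  exists2 K : R, 0 <= K & forall z, (forall b, root Q b -> d <= cmod (z - b)) ->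
    cmod P.[z] <= K * cmod Q.[z].
Proof.
move=> d0 Q0 sPQ; have [lc [rs [E lc0 srs rsE]]] := poly_factor Q.
have [|K K0 hK] := @poly_le_prod d rs P d0; first by rewrite -srs.
exists (K / cmod lc) => [|z hz]; first by rewrite divr_ge0 ?cmod_ge0.
apply: le_trans (hK z _) _ => [b|]; first by rewrite rsE //; exact: hz.
rewrite E hornerZ cmodM mulrA divfK // cmod_eq0; exact: lc0.
Qed.

Lemma exists_near_notin (bad : seq C) s (eta : R) : 0 < eta ->
  exists2 x, cmod (x - s) < eta & x \notin bad.
Proof.
move=> eta0.
pose x (n : nat) : C := s + (eta / n.+2%:R)%:C.
have x_inj : injective x.
  move=> m n /addrI /(congr1 (@complex.Re R)) /= /(mulfI (lt0r_neq0 eta0)).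
  by move=> /invr_inj /eqP; rewrite eqr_nat => /eqP [].
have [/allP sub|/allPn [_ /mapP [n _ ->] nb]] :=
    boolP (all (mem bad) [seq x n | n <- iota 0 (size bad).+1]).
  have : uniq [seq x n | n <- iota 0 (size bad).+1].
    by rewrite map_inj_uniq ?iota_uniq.
  by move=> /uniq_leq_size /(_ sub); rewrite size_map size_iota ltnn.
exists (x n) => //; rewrite /x addrAC subrr add0r cmod_real; last first.
  by rewrite divr_ge0 // ltW.
by rewrite ltr_pdivrMr // ltr_pMr // ltr1n.
Qed.

Lemma common_radius (T : eqType) (A : seq T) (S : T -> R -> Prop) :
  (forall (a : T) (d d' : R), S a d -> 0 < d' -> d' <= d -> S a d') ->
  (forall a : T, a \in A -> exists2 d : R, 0 < d & S a d) ->
  exists2 d : R, 0 < d & forall a : T, a \in A -> S a d.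
Proof.
move=> Sle; elim: A => [|a A IH] h; first by exists 1.
have [|d d0 hd] := IH; first by move=> b bA; apply: h; rewrite in_cons bA orbT.
have [d' d'0 hd'] := h a (mem_head _ _).
have m0 : 0 < Num.min d d' by rewrite lt_min d0.
exists (Num.min d d') => // b; rewrite in_cons => /orP[/eqP ->|/hd].
  by apply: Sle hd' m0 _; rewrite ge_min lexx orbT.
by move=> /Sle; apply => //; rewrite ge_min lexx.
Qed.

Lemma well_separated_exists (A : seq C) :
  exists2 d : R, 0 < d & well_separated A d.
Proof.
have [|a aA|d d0 hd] := @common_radius C A
    (fun a d => forall b, b \in A -> a != b -> 2 * d <= cmod (a - b)).
- by move=> a d d' h _ dd b bA ab; have := h b bA ab; lra.
- apply: (@common_radius C A (fun b d => a != b -> 2 * d <= cmod (a - b))).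
    by move=> b d d' h _ dd ab; have := h ab; lra.
  move=> b _; have [->|ab] := eqVneq a b; first by exists 1.
  exists (cmod (a - b) / 2) => [|_].
    by rewrite divr_gt0 ?cmod_gt0 ?subr_eq0.
  lra.
- by exists d => // a b aA bA; exact: hd.
Qed.

Lemma expands_on_exists (A : seq C) (f : C -> C) :
  (forall a, a \in A -> analytic_at f a) ->
  exists (d M : R), [/\ 0 < d, 0 <= M &
    forall d', 0 < d' -> d' <= d -> expands_on A d' M f].
Proof.
elim: A => [|a A IH] h; first by exists 1, 0.
have [|d [M [d0 M0 hd]]] := IH.
  by move=> b bA; apply: h; rewrite in_cons bA orbT.
have [d1 [M1 [d10 ex]]] := analytic_expands (h a (mem_head _ _)).
have M10 := expands_ge0 ex.
exists (Num.min d d1), (M + M1); split; [by rewrite lt_min d0|exact: addr_ge0|].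
move=> d' d'0; rewrite le_min => /andP[dd dd1] b.
rewrite in_cons => /orP[/eqP ->|bA].
  by apply: expands_le ex; rewrite ?lerDr.
by apply: expands_le (hd d' d'0 dd b bA); rewrite ?lerDl.
Qed.

(** Divide the polynomial [P] by the factors [z - b] of [Q] one at a time, on a
  disk around [a] away from all [b]. *)
Lemma expands_rational P Q a : Q.[a] != 0 ->
  exists (d M : R), 0 < d /\ expands a d M (fun z => P.[z] / Q.[z]).
Proof.
move=> Qa; have Q0 : Q != 0 by apply: contraNneq Qa => ->; rewrite horner0.
have [lc [rs [E lc0 _ rsE]]] := poly_factor Q.
have [d d0 sep] := well_separated_exists (a :: rs).
have far b : b \in rs -> 2 * d <= cmod (a - b).
  move=> brs; apply: sep; rewrite ?mem_head // ?in_cons ?brs ?orbT //.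
  by apply: contraNneq Qa => ->; rewrite -rootE -rsE.
have [K _ hK] := expands_on_poly [:: a] P d0.
have exP : expands a d (K * cmod 1) (fun z => P.[z] * 1).
  apply: hK; rewrite ?mem_head // => b; rewrite in_cons orbF => /eqP ->.
  exact: expands_cst.
suff [M exM] : exists M, expands a d M (fun z => (P.[z] * 1) /
    (\prod_(b <- rs) ('X - b%:P)).[z]).
  exists d, (cmod lc^-1 * M); split=> //.
  apply: expands_ext (expandsZ lc^-1 exM) => z _.
  by rewrite [in RHS]E hornerZ invfM mulr1 mulrCA.
elim: rs far {E rsE sep} => [|b rs IH] far.
  exists (K * cmod 1); apply: expands_ext exP => z _.
  by rewrite big_nil hornerC invr1 !mulr1.
have [|M exM] := IH.
  by move=> c crs; apply: far; rewrite in_cons crs orbT.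
exists (2 * M / d); have := expandsDsub d0 (far b (mem_head _ _)) exM.
apply: expands_ext => z _.
by rewrite big_cons hornerM hornerXsubC invfM mulrAC -mulrA (mulrC _^-1).
Qed.

(** The difference quotients of [f] are the values of [g], which is continuous
  at [a]. *)
Lemma derive1_slope (f g : C -> C) a (d M : R) : 0 < d -> expands a d M g ->
  (forall z, z != a -> cmod (z - a) < d -> (f z - f a) / (z - a) = g z) ->
  derive1 f a = g a.
Proof.
move=> d0 ex slope; have M0 := expands_ge0 ex.
have L0 : 0 <= M / d by rewrite divr_ge0 // ltW.
apply: cvg_lim => //; apply/cvgrPdist_lt => _ /cplx_gt0 [e e0 ->].
have r0 : 0 < Num.min d (e / (M / d + 1)).
  by rewrite lt_min d0 divr_gt0 //; lra.
exists (Num.min d (e / (M / d + 1)))%:C; first by rewrite /= ltcR.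
move=> h /=; rewrite sub0r normrN cmodE ltcR lt_min => /andP[hd he] h0.
have hE : h + a - a = h by rewrite addrK.
have -> : h^-1 *: (f (h + a) - f a) = g (h + a).
  rewrite -slope ?hE //; last by rewrite -subr_eq0 hE.
  by rewrite mulrC.
rewrite cmodE ltcR cmodBC.
have := @expands_lipschitz _ _ _ _ _ (h + a) d0 ex; rewrite hE => /(_ hd) h1.
apply: le_lt_trans h1 _; move: he; rewrite ltr_pdivlMr ?mulrDr; last by lra.
by have := cmod_ge0 h; lra.
Qed.

End Polynomials.

(** * Fibres and state space of a rational function *)

Section RationalFunctions.
Variables (R : realType) (p q : {poly cplx R}).
Local Notation C := (cplx R).
Local Notation r := (ratfun p q).
Implicit Types (a b z s : C).
Hypothesis coprime_pq : coprimep p q.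
Hypothesis q_neq0 : q != 0.
Hypothesis deg_qp : (size q <= size p)%N.
Hypothesis p_nonconst : (1 < size p)%N.

Definition fibre s : {poly C} := p - s *: q.

Lemma fibreE s z : regular q z -> (fibre s).[z] = (r z - s) * q.[z].
Proof.
by move=> qz; rewrite /fibre !hornerE /ratfun mulrBl divfK.
Qed.

Lemma root_fibre s z : root (fibre s) z -> regular q z /\ r z = s.
Proof.
move=> rz; have qz : regular q z.
  apply/negP => /eqP qz; have : root p z.
    by move: rz; rewrite !rootE /fibre !hornerE qz mulr0 subr0.
  by move/(coprimep_root coprime_pq); rewrite qz eqxx.
split=> //; move: rz; rewrite rootE fibreE // mulf_eq0 (negPf qz) orbF.
by rewrite subr_eq0 => /eqP.
Qed.

(** Away from its roots, [p - s q] dominates [q] because it has at least the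
  same degree, whereas its modulus is [|r - s|] times that of [q]. *)
Lemma fibre_covering s (d : R) : 0 < d -> size (fibre s) = size p ->
  exists2 eps : R, 0 < eps & forall z, regular q z -> cmod (r z - s) < eps ->
    exists2 b, root (fibre s) b & cmod (z - b) < d.
Proof.
move=> d0 sfib.
have fib0 : fibre s != 0.
  by rewrite -size_poly_gt0 sfib (ltn_trans _ p_nonconst).
have [|K K0 hK] := @poly_dominated R d q (fibre s) d0 fib0.
  by rewrite sfib.
exists (K + 1)^-1 => [|z qz]; first by rewrite invr_gt0; lra.
rewrite -[_^-1]div1r ltr_pdivlMr; last by lra.
move=> small; apply: contrapT => far.
have /hK : forall b, root (fibre s) b -> d <= cmod (z - b).
  by move=> b rb; rewrite leNgt; apply/negP => zb; apply: far; exists b.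
rewrite fibreE // cmodM mulrA -ler_pdivrMr; last by rewrite cmod_gt0.
rewrite divff ?cmod_eq0 //; have := cmod_ge0 (r z - s); lra.
Qed.

(** When the degree drops, [s] is the value of the rational function at
  infinity, near which it would take values of modulus less than [rho]. *)
Lemma size_fibre (rho B : R) s :
  (forall z, regular q z -> cmod (r z) < rho -> cmod z <= B) ->
  cmod s < rho -> size (fibre s) = size p.
Proof.
move=> bounded srho; have sle : (size (fibre s) <= size p)%N.
  rewrite (leq_trans (size_polyD _ _)) // geq_max leqnn size_polyN.
  by rewrite (leq_trans (size_scale_leq _ _)).
apply/eqP; rewrite eqn_leq sle /= leqNgt; apply/negP => slt.
have sqp : size q = size p.
  apply/eqP; rewrite eqn_leq deg_qp leqNgt; apply/negP => qlt.
  move: slt; rewrite /fibre size_polyDl ?ltnn // size_polyN.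
  by rewrite (leq_ltn_trans (size_scale_leq _ _)).
have sX : (size (fibre s * 'X)%R <= size q)%N.
  have [->|f0] := eqVneq (fibre s) 0; first by rewrite mul0r size_poly0.
  by rewrite size_mulX // sqp.
(* Since [deg (p - s q) < deg q], the function [r - s] is [O(1/z)]; the point
   [T] is chosen so large that it is outside the disk of radius [B] and
   [|r T - s| < rho - |s|]. *)
have [K K0 hK] := poly_dominated ltr01 q_neq0 sX.
have [lc [rs [_ _ _ rsE]]] := poly_factor q.
have gap : 0 < rho - cmod s by lra.
pose bs := \sum_(b <- rs) cmod b.
have bs0 : 0 <= bs by apply: sumr_ge0 => b _; exact: cmod_ge0.
pose T : R := 2 + bs + `|B| + K / (rho - cmod s).
have Kg : 0 <= K / (rho - cmod s) by rewrite divr_ge0 // ltW.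
have B0 := normr_ge0 B; have BB := ler_norm B.
have T0 : 0 <= T by rewrite /T; lra.
have far b : root q b -> 1 <= cmod (T%:C - b).
  rewrite -rsE // => brs.
  have bbs : cmod b <= bs.
    rewrite /bs (big_rem b) //= lerDl; apply: sumr_ge0 => c _; exact: cmod_ge0.
  have := cmodD (T%:C - b) b; rewrite subrK cmod_real // /T; lra.
have qT : regular q T%:C.
  by apply/negP => /far; rewrite subrr cmod0 ler10.
have rT : cmod (r T%:C - s) < rho - cmod s.
  have := hK T%:C far; rewrite hornerMX fibreE // !cmodM cmod_real // mulrAC.
  rewrite ler_pM2r ?cmod_gt0 // => h.
  have TK : K < T * (rho - cmod s).
    by rewrite -ltr_pdivrMr // /T; lra.
  have T1 : 0 < T by rewrite /T; lra.
  by rewrite -(ltr_pM2r T1); apply: le_lt_trans h _; rewrite mulrC.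
have : cmod (r T%:C) < rho.
  by have := cmodD (r T%:C - s) s; rewrite subrK; lra.
by move=> /(bounded _ qT); rewrite cmod_real // /T; lra.
Qed.

(** A multiple root of [p - s q] is a zero of the Wronskian [p' q - p q'], which
  is a nonzero polynomial; the exceptional [s] are the values of [r] at its
  zeros. *)
Lemma generic_fibre : exists bad : seq C, forall s, s \notin bad ->
  size (fibre s) = size p ->
  exists rs : seq C, [/\ uniq rs, size rs = (size p).-1 &
    forall a, a \in rs -> regular q a /\ r a = s].
Proof.
pose W := p^`() * q - p * q^`().
have p'0 : p^`() != 0.
  have p0 : lead_coef p != 0 by rewrite lead_coef_eq0 -size_poly_gt0 ltnW.
  have [n sn] : exists n, size p = n.+2.
    by case: (size p) p_nonconst => [|[|n]] // _; exists n.
  apply: contraNneq p0 => p'0; have := coef_deriv p n.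
  by rewrite p'0 coef0 lead_coefE sn => /esym/eqP; rewrite mulrn_eq0.
have W0 : W != 0.
  rewrite /W subr_eq0; apply/negP => /eqP E.
  have : p %| p^`() * q by rewrite E dvdp_mulr.
  rewrite Gauss_dvdpl // => /(dvdp_leq p'0).
  by rewrite leqNgt lt_size_deriv // -size_poly_gt0 ltnW.
have [_ [ws [_ _ _ wsE]]] := poly_factor W.
exists [seq r a | a <- ws] => s sbad sfib.
have [lc [rs [E lc0 srs rsE]]] := poly_factor (fibre s).
have fib0 : fibre s != 0.
  by rewrite -size_poly_gt0 sfib ltnW.
exists rs; split.
- rewrite -separable_prod_XsubC unlock.
  apply: Pdiv.ClosedField.root_coprimep => a ra; apply: contra sbad => ra'.
  have rfa : root (fibre s) a by rewrite E rootE hornerZ (eqP ra) mulr0.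
  have [qa <-] := root_fibre rfa; apply: map_f; rewrite wsE // rootE.
  have : (fibre s)^`().[a] = 0.
    by rewrite E derivZ hornerZ (eqP ra') mulr0.
  rewrite /fibre derivB derivZ !hornerE => /eqP; rewrite subr_eq0 => /eqP E1.
  move: rfa; rewrite rootE /fibre !hornerE subr_eq0 => /eqP E2.
  by rewrite E1 E2; apply/eqP; ring.
- by have := srs fib0; rewrite sfib => ->.
- by move=> a; rewrite rsE // => /root_fibre.
Qed.

(** The numerator [q(a) p - p(a) q] of [r - r(a)] vanishes at [a]; its quotient
  by [z - a] is [u], up to a constant. *)
Lemma diffquot_poly a : regular q a ->
  exists2 u : {poly C}, (size u <= (size p).-1)%N &
    forall z, regular q z -> diffquot p q a z = u.[z] / q.[z].
Proof.
move=> qa.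
have /factor_theorem [u E] : root (q.[a] *: p - p.[a] *: q) a.
  by rewrite rootE !hornerE mulrC subrr.
have uE z : u.[z] * (z - a) = q.[a] * p.[z] - p.[a] * q.[z].
  by have := congr1 (horner^~ z) E; rewrite !hornerE.
have slope z : regular q z -> z != a ->
    (r z - r a) / (z - a) = (q.[a]^-1 *: u).[z] / q.[z].
  move=> qz za; have za0 : z - a != 0 by rewrite subr_eq0.
  apply: (mulIf za0); rewrite divfK // hornerZ mulrAC.
  rewrite -(mulrA _ u.[z]) uE /ratfun.
  by field; rewrite qz qa.
exists (q.[a]^-1 *: u) => [|z qz].
  rewrite (leq_trans (size_scale_leq _ _)) //.
  have [->|u0] := eqVneq u 0; first by rewrite size_poly0.
  have : (size (q.[a] *: p - p.[a] *: q)%R <= size p)%N.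
    rewrite (leq_trans (size_polyD _ _)) // geq_max size_polyN.
    by rewrite !(leq_trans (size_scale_leq _ _)).
  rewrite E size_Mmonic ?monicXsubC // size_XsubC addn2 /=.
  by case: (size p) p_nonconst.
rewrite /diffquot; case: eqVneq => [->|za]; last exact: slope.
have [d [M [d0 ex]]] := expands_rational (q.[a]^-1 *: u) qa.
have [_ [rs [_ _ _ rsE]]] := poly_factor q.
have [d' d'0 sep] := well_separated_exists (a :: rs).
have m0 : 0 < Num.min d d' by rewrite lt_min d0.
have exm : expands a (Num.min d d') M
    (fun z => (q.[a]^-1 *: u).[z] / q.[z]).
  by apply: expands_le ex; rewrite ?ge_min ?lexx.
apply: (derive1_slope m0 exm) => y ya; rewrite lt_min => /andP[_ yd].
apply: slope ya; apply/negP => qy.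
have ay : a != y by apply: contraNneq qa => ->.
have := sep a y (mem_head _ _); rewrite in_cons rsE // rootE qy orbT.
by move=> /(_ isT ay); rewrite cmodBC; lra.
Qed.

Lemma state_space_poly g : state_space p q g ->
  exists2 u : {poly C}, (size u <= (size p).-1)%N &
    forall z, regular q z -> g z = u.[z] / q.[z].
Proof.
move=> [n [a [b [ra gE]]]].
have /choice [u hu] : forall i, exists u : {poly C},
    (size u <= (size p).-1)%N /\
    forall z, regular q z -> diffquot p q (a i) z = u.[z] / q.[z].
  by move=> i; have [u su uE] := diffquot_poly (ra i); exists u.
exists (\sum_(i < n) b i *: u i).
  rewrite (leq_trans (size_sum _ _ _)) //; apply/bigmax_leqP => i _.
  by rewrite (leq_trans (size_scale_leq _ _)) //; case: (hu i).
move=> z qz; rewrite gE // horner_sum mulr_suml; apply: eq_bigr => i _.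
by have [_ ->] := hu i; rewrite // hornerZ mulrA.
Qed.

(** Row [i] of [U] holds the coefficients of the numerator of [e i].  These [N]
  numerators are linearly independent in the [N]-dimensional space of
  polynomials of degree less than [N], hence [U] is invertible, and every such
  polynomial is a combination of them. *)
Lemma state_space_basis_mx (e : 'I_(size p).-1 -> C -> C) :
  state_space_basis p q e ->
  exists2 U : 'M[C]_((size p).-1), U \in unitmx &
    forall (v : 'cV[C]_((size p).-1)) z, regular q z ->
      \sum_i e i z * v i 0 = (rVpoly (v^T *m U)).[z] / q.[z].
Proof.
move=> [e_state e_free _].
have /choice [u hu] : forall i, exists u : {poly C},
    (size u <= (size p).-1)%N /\
    forall z, regular q z -> e i z = u.[z] / q.[z].
  by move=> i; have [u su uE] := state_space_poly (e_state i); exists u.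
pose U := \matrix_i poly_rV (u i) : 'M[C]_((size p).-1).
have UE (v : 'cV[C]_((size p).-1)) z : regular q z ->
    \sum_i e i z * v i 0 = (rVpoly (v^T *m U)).[z] / q.[z].
  move=> qz; rewrite mulmx_sum_row linear_sum horner_sum mulr_suml.
  apply: eq_bigr => i _; have [su uE] := hu i.
  by rewrite linearZ /= rowK poly_rV_K // hornerZ mxE uE // mulrC mulrA.
exists U => //; rewrite -row_free_unit; apply: inj_row_free => v vU.
apply/rowP => i; rewrite mxE; apply: (e_free (fun i => v 0 i)) => z qz.
have := UE v^T z qz; rewrite trmxK vU linear0 horner0 mul0r => vz.
by rewrite -[RHS]vz; apply: eq_bigr => j _; rewrite mxE mulrC.
Qed.

End RationalFunctions.

(** * Local solutions and uniqueness *)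

Section LocalSolutions.
Variables (R : realType) (p q : {poly cplx R}).
Local Notation C := (cplx R).
Local Notation r := (ratfun p q).
Local Notation N := (size p).-1.
Hypothesis coprime_pq : coprimep p q.
Hypothesis deg_qp : (size q <= size p)%N.
Hypothesis p_nonconst : (1 < size p)%N.
(* The data that [state_space_basis_mx] provides. *)
Variables (e : 'I_N -> C -> C) (U : 'M[C]_N).
Hypothesis U_unit : U \in unitmx.
Hypothesis eU : forall (v : 'cV[C]_N) z, regular q z ->
  \sum_i e i z * v i 0 = (rVpoly (v^T *m U)).[z] / q.[z].

(** At a nearby generic value [x], the polynomial with coordinates [H x]
  vanishes at the [N] distinct points of the fibre, so [H x = 0]; by continuity
  [H s = 0]. *)
Lemma representation_unique (H : C -> 'cV[C]_N) (s : C) (eta Lam : R) :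
  0 < eta -> (forall x, cmod (x - s) < eta -> size (fibre p q x) = size p) ->
  (forall i x, cmod (x - s) < eta ->
    cmod (H x i 0 - H s i 0) <= Lam * cmod (x - s)) ->
  (forall z, regular q z -> cmod (r z - s) < eta ->
    \sum_i e i z * H (r z) i 0 = 0) ->
  H s = 0.
Proof.
move=> eta0 sfib Hlip Hrep; apply/colP => i; rewrite mxE; apply/eqP.
apply: contraT => Hsi; pose d := cmod (H s i 0).
have d0 : 0 < d by rewrite cmod_gt0.
have L0 := normr_ge0 Lam; have L1 : 0 < `|Lam| + 1 by lra.
have [bad hbad] := generic_fibre coprime_pq p_nonconst.
have m0 : 0 < Num.min eta (d / (`|Lam| + 1)) by rewrite lt_min eta0 divr_gt0.
have [x xs xbad] := exists_near_notin bad s m0.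
move: xs; rewrite lt_min => /andP[xeta xd].
have [rs [rs_uniq srs rsE]] := hbad x xbad (sfib x xeta).
have w0 : rVpoly ((H x)^T *m U) = 0.
  apply/eqP; apply: contraT => w0.
  have := max_poly_roots w0 _ rs_uniq; rewrite srs ltnNge size_poly; apply.
  apply/allP => a /rsE [qa ra]; have := eU (H x) qa.
  have := Hrep a qa; rewrite ra => -> // /esym/eqP.
  by rewrite mulf_eq0 invr_eq0 (negPf qa) orbF rootE.
have Hx : H x = 0.
  have := congr1 (@poly_rV _ N) w0; rewrite rVpolyK linear0 => HU.
  by apply: trmx_inj; rewrite -(mulmxK U_unit (H x)^T) HU mul0mx trmx0.
have := Hlip i x xeta; rewrite Hx mxE sub0r cmodN -/d.
move: xd; rewrite ltr_pdivlMr // mulrDr mulr1 mulrC => xd.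
have := ler_wpM2r (cmod_ge0 (x - s)) (ler_norm Lam); have := cmod_ge0 (x - s).
by move=> h1 h2 h3; lra.
Qed.

(** The Lipschitz estimate makes the local solution continuous at all points
  near [s0], so that [representation_unique] can compare it with the local
  solutions around these points. *)
Lemma local_solution (f : C -> C) (s0 : C) :
  size (fibre p q s0) = size p ->
  (forall a, root (fibre p q s0) a -> analytic_at f a) ->
  exists (F : C -> 'cV[C]_N) (eps Lam : R), [/\ 0 < eps, analytic_at F s0,
    forall i s t, cmod (s - s0) < eps -> cmod (t - s0) < eps ->
      cmod (F s i 0 - F t i 0) <= Lam * cmod (s - t) &
    forall z, regular q z -> cmod (r z - s0) < eps ->
      f z = \sum_i e i z * F (r z) i 0].
Proof.
move=> sfib f_an.
have fib0 : fibre p q s0 != 0 by rewrite -size_poly_gt0 sfib ltnW.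
have [lc [rs [E /(_ fib0) lc0 /(_ fib0) srs /(_ fib0) rsE]]] :=
  poly_factor (fibre p q s0).
have {}srs : size rs = N by rewrite -sfib srs.
have [|d1 [M1 [d10 M10 exf]]] := @expands_on_exists R rs f.
  by move=> a; rewrite rsE; exact: f_an.
have [d2 d20 sep2] := well_separated_exists rs.
pose d := Num.min d1 d2; have d0 : 0 < d by rewrite lt_min d10.
have dd2 : d <= d2 by rewrite ge_min lexx orbT.
have sep : well_separated rs d.
  by move=> a b ars brs ab; have := sep2 a b ars brs ab; lra.
have {}exf : expands_on rs d M1 f by apply: exf; rewrite // ge_min lexx.
have [Kq Kq0 hKq] := expands_on_poly rs q d0.
have exqf := hKq _ _ exf; set M := Kq * M1 in exqf.
have M0 : 0 <= M by exact: mulr_ge0.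
have [K K1 hK] := division_expansion q d0 sep (fun x => id) lc0.
have K0 : 0 < K by lra.
have [u [su cu uE]] := hK _ _ M0 exqf.
have [eps0 eps00 cover] :=
  fibre_covering deg_qp p_nonconst d0 sfib.
(* Coordinates of [u n / q] in the basis [e]. *)
pose c i n := (poly_rV (u n) *m invmx U) 0 i.
pose S := \sum_(i < N) \sum_(j < N) cmod (invmx U j i).
have c_le i n : cmod (c i n) <= K * M * S * K ^+ n.
  rewrite /c mxE; apply: le_trans (cmod_sum _ _ _) _.
  rewrite mulrAC; apply: (@le_trans _ _
    (\sum_j K * M * K ^+ n * cmod (invmx U j i))).
    by apply: ler_sum => j _; rewrite cmodM mxE ler_wpM2r ?cmod_ge0 ?cu.
  rewrite -mulr_sumr ler_wpM2l //.
    by rewrite !mulr_ge0 ?exprn_ge0 ?(ltW K0).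
  rewrite [leRHS](bigD1 i) //= lerDl; apply: sumr_ge0 => j _.
  by apply: sumr_ge0 => k _; exact: cmod_ge0.
set B := K * M * S in c_le.
have /choice [Phi hPhi] := fun i => power_series s0 K0 (c_le i).
have r0 : 0 < (4 * K)^-1 by rewrite invr_gt0 mulr_gt0.
pose eps := Num.min eps0 (4 * K)^-1.
have eps_le s : cmod (s - s0) < eps -> cmod (s - s0) <= (4 * K)^-1.
  by rewrite lt_min => /andP[_ /ltW].
exists (fun s => \col_i Phi i s), eps, (8 * B * K); split.
- by rewrite lt_min eps00.
- apply: (@analytic_col _ _ _ c _ _ r0) => i s /ltW sr; rewrite mxE.
  by have [h _] := hPhi i; exact: h.
- move=> i s t /eps_le sr /eps_le tr; rewrite !mxE.
  by have [_ [_ h]] := hPhi i; exact: h.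
move=> z qz zs; have sr := eps_le _ zs.
have [|b] := cover z qz; first by apply: lt_le_trans zs _; rewrite ge_min lexx.
rewrite -rsE => brs zb; pose s := r z - s0.
have {}uE k : cmod (q.[z] * f z - \sum_(n < k) (u n).[z] * s ^+ n)
    <= M * 2^-1 ^+ k.
  have := uE b z k brs zb qz; rewrite /= -E fibreE // mulfK // -/s => h.
  apply: le_trans h _; rewrite ler_wpM2l // lerXn2r ?nnegrE ?invr_ge0 //.
    by rewrite mulr_ge0 ?cmod_ge0 ?(ltW K0).
  have := ler_wpM2l (ltW K0) sr; rewrite -/s invfM mulrCA divff ?gt_eqF //.
  lra.
have partial k : \sum_i e i z * (\sum_(n < k) c i n * s ^+ n)
    = (\sum_(n < k) (u n).[z] * s ^+ n) / q.[z].
  have := eU (\col_i \sum_(n < k) c i n * s ^+ n) qz.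
  under eq_bigr do rewrite mxE.
  move=> ->; congr (_ / _).
  have -> : (\col_i \sum_(n < k) c i n * s ^+ n)^T *m U
      = \sum_(n < k) s ^+ n *: poly_rV (u n).
    rewrite -[RHS](mulmxKV U_unit); congr (_ *m _).
    apply/rowP => i; rewrite mulmx_suml summxE !mxE.
    by apply: eq_bigr => n _; rewrite -scalemxAl mxE mulrC.
  rewrite linear_sum horner_sum; apply: eq_bigr => n _.
  by rewrite linearZ /= poly_rV_K -?srs // hornerZ mulrC.
apply/eqP; rewrite -subr_eq0 -cmod_eq0 eq_le cmod_ge0 andbT.
under eq_bigr do rewrite mxE.
apply: (@le0_geometric _ _
  (M / cmod q.[z] + \sum_i cmod (e i z) * (2 * B))) => m.
have -> : f z - \sum_i e i z * Phi i (r z) =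
    (q.[z] * f z - \sum_(n < m) (u n).[z] * s ^+ n) / q.[z]
    - \sum_i e i z * (Phi i (r z) - \sum_(n < m) c i n * s ^+ n).
  have -> : \sum_i e i z * (Phi i (r z) - \sum_(n < m) c i n * s ^+ n)
      = \sum_i e i z * Phi i (r z)
        - \sum_i e i z * (\sum_(n < m) c i n * s ^+ n).
    by rewrite -sumrB; apply: eq_bigr => i _; rewrite mulrBr.
  by rewrite partial mulrBl mulrAC divff // mul1r; ring.
apply: le_trans (cmodB _ _) _; rewrite [leRHS]mulrDl; apply: lerD.
  by rewrite cmodM cmodV mulrAC ler_wpM2r ?invr_ge0 ?cmod_ge0.
apply: le_trans (cmod_sum _ _ _) _; rewrite mulr_suml; apply: ler_sum => i _.
rewrite cmodM -mulrA ler_wpM2l ?cmod_ge0 //.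
by have [_ [h _]] := hPhi i; exact: h.
Qed.

End LocalSolutions.

Section AnalyticMaps.
Variables (R : realType).
Local Notation C := (cplx R).

Lemma analytic_lipschitz_at N (F : C -> 'cV[C]_N) (s : C) : analytic_at F s ->
  exists eta Lam : R, 0 < eta /\ forall i x, cmod (x - s) < eta ->
    cmod (F x i 0 - F s i 0) <= Lam * cmod (x - s).
Proof.
move=> F_an; have /choice [dM hdM] : forall i, exists dM : R * R,
    0 < dM.1 /\ expands s dM.1 dM.2 (fun x => F x i 0).
  by move=> i; have [d [M hM]] := analytic_expands (analytic_coord i F_an);
    exists (d, M).
have [|i _|eta eta0 heta] := @common_radius R 'I_N (enum 'I_N)
    (fun i d => d <= (dM i).1).
- by move=> i d d' h _ dd; exact: le_trans h.
- by exists (dM i).1 => //; case: (hdM i).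
have L0 i : 0 <= (dM i).2 / (dM i).1.
  by have [d0 ex] := hdM i; rewrite divr_ge0 ?(expands_ge0 ex) // ltW.
exists eta, (\sum_i (dM i).2 / (dM i).1); split=> // i x xs.
have [d0 ex] := hdM i.
have xd : cmod (x - s) < (dM i).1.
  by apply: lt_le_trans xs _; apply: heta; rewrite mem_enum.
apply: le_trans (expands_lipschitz d0 ex xd) _.
rewrite ler_wpM2r ?cmod_ge0 // (bigD1 i) //= lerDl.
by apply: sumr_ge0 => j _.
Qed.

Lemma analytic_at_ext N (F G : C -> 'cV[C]_N) (s : C) (eta : R) : 0 < eta ->
  (forall x, cmod (x - s) < eta -> F x = G x) ->
  analytic_at F s -> analytic_at G s.
Proof.
move=> eta0 FG [c [e [e0 h]]]; exists c, (Num.min e eta).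
split=> [|x /cplx_ballE]; first by rewrite lt_min e0.
by rewrite lt_min => /andP[xe xeta]; rewrite -FG //; apply/h/cplx_ballE.
Qed.

End AnalyticMaps.

(** * The representation theorem *)

Theorem theorem4p1 (R : realType) (p q : {poly cplx R})
    (coprime_pq : coprimep p q) (q_neq0 : q != 0)
    (deg_qp : (size q <= size p)%N) (p_nonconst : (1 < size p)%N)
    (e : 'I_(size p).-1 -> cplx R -> cplx R)
    (e_basis : state_space_basis p q e)
    (L : nat) (w : 'I_L -> cplx R) (w_inj : injective w)
    (w_zeros : range w = zero_set p q)
    (c : 'I_L -> cplx R) (rad : 'I_L -> R) (D : 'I_L -> set (cplx R))
    (rad_gt0 : forall l, 0 < rad l)
    (D_disk : forall l, D l = ball (c l) ((rad l)%:C : cplx R))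
    (D_disjoint : trivIset setT D)
    (w_in_D : forall l, D l (w l))
    (D_regular : forall l, D l `<=` regular q)
    (frontier_regular : \bigcup_l frontier (D l) `<=` regular q)
    (rho : R)
    (rho_min : is_min_modulus p q (\bigcup_l frontier (D l)) rho)
    (sublevel_D : sublevel p q rho `<=` \bigcup_l D l)
    (f : cplx R -> cplx R)
    (f_analytic : analytic_near (\bigcup_l closure (D l)) f) :
  let representation (F : cplx R -> 'cV[cplx R]_(size p).-1) :=
    analytic_on (ball (0 : cplx R) (rho%:C : cplx R)) F /\
    (forall z, sublevel p q rho z ->
       f z = (Zrow e z *m F (ratfun p q z)) 0 0) in
  exists F, representation F /\
    forall G, representation G ->
      forall s, ball (0 : cplx R) (rho%:C : cplx R) s -> G s = F s.
Proof.
move=> representation.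
have [U U_unit eU] := state_space_basis_mx q_neq0 deg_qp p_nonconst e_basis.
have repE (F : cplx R -> 'cV[cplx R]_((size p).-1)) z :
    (Zrow e z *m F (ratfun p q z)) 0 0 = \sum_i e i z * F (ratfun p q z) i 0.
  by rewrite mxE; apply: eq_bigr => i _; rewrite mxE.
have subE z : sublevel p q rho z <-> regular q z /\ cmod (ratfun p q z) < rho.
  by rewrite /sublevel /= cmodE ltcR.
have ballE0 (s : cplx R) :
    ball (0 : cplx R) (rho%:C : cplx R) s <-> cmod s < rho.
  by split=> [/cplx_ballE|srho]; [|apply/cplx_ballE]; rewrite subr0.
have bounded z : regular q z -> cmod (ratfun p q z) < rho ->
    cmod z <= \sum_l (cmod (c l) + rad l).
  move=> qz zrho; have /subE/sublevel_D [l _] : regular q z /\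
    cmod (ratfun p q z) < rho by [].
  rewrite D_disk => /cplx_ballE zl.
  have := cmodD (z - c l) (c l); rewrite subrK => h.
  apply: le_trans h _; rewrite (bigD1 l) //=.
  have : 0 <= \sum_(i < L | i != l) (cmod (c i) + rad i).
    by apply: sumr_ge0 => i _; rewrite addr_ge0 ?cmod_ge0 // ltW.
  lra.
have sfib s : cmod s < rho -> size (fibre p q s) = size p.
  exact: size_fibre bounded.
have f_an s a : cmod s < rho -> root (fibre p q s) a -> analytic_at f a.
  move=> srho /(root_fibre coprime_pq) [qa ra].
  have [V [_ KV V_an]] := f_analytic; apply/V_an/KV.
  have /subE/sublevel_D [l _ al] : regular q a /\ cmod (ratfun p q a) < rho.
    by rewrite ra.
  by exists l => //; exact: subset_closure.
have near_rho (s x : cplx R) : cmod (x - s) < rho - cmod s -> cmod x < rho.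
  by have := cmodD (x - s) s; rewrite subrK; lra.
(* [F0 s] is a local solution around [s], defined as a function on the whole
   plane; the global solution is the diagonal [s |-> F0 s s]. *)
have /choice [F0 hF0] : forall s : cplx R,
    exists F : cplx R -> 'cV[cplx R]_((size p).-1), cmod s < rho ->
    exists eps Lam : R, [/\ 0 < eps, analytic_at F s,
      forall i x y, cmod (x - s) < eps -> cmod (y - s) < eps ->
        cmod (F x i 0 - F y i 0) <= Lam * cmod (x - y) &
      forall z, regular q z -> cmod (ratfun p q z - s) < eps ->
        f z = \sum_i e i z * F (ratfun p q z) i 0].
  move=> s; have [srho|nsrho] := boolP (cmod s < rho); last by exists (fun=> 0).
  have [F hF] := local_solution deg_qp p_nonconst U_unit eU
    (sfib s srho) (fun a => @f_an s a srho).
  by exists F.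
(* Solutions that represent f near the fibre of s and are Lipschitz at s take
   the same value there. *)
have unique (F G : cplx R -> 'cV[cplx R]_((size p).-1)) (s : cplx R)
    (eta LF LG : R) : cmod s < rho -> 0 < eta ->
    (forall i x, cmod (x - s) < eta ->
      cmod (F x i 0 - F s i 0) <= LF * cmod (x - s)) ->
    (forall i x, cmod (x - s) < eta ->
      cmod (G x i 0 - G s i 0) <= LG * cmod (x - s)) ->
    (forall z, regular q z -> cmod (ratfun p q z) < rho ->
      cmod (ratfun p q z - s) < eta -> \sum_i e i z * F (ratfun p q z) i 0
        = \sum_i e i z * G (ratfun p q z) i 0) ->
    F s = G s.
  move=> srho eta0 Flip Glip FG; apply/eqP; rewrite -subr_eq0; apply/eqP.
  have m0 : 0 < Num.min eta (rho - cmod s) by rewrite lt_min eta0; lra.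
  apply: (representation_unique coprime_pq p_nonconst U_unit eU
    (H := fun x => F x - G x) (Lam := LF + LG) m0).
  - by move=> x; rewrite lt_min => /andP[_ /near_rho]; exact: sfib.
  - move=> i x; rewrite lt_min => /andP[xeta _]; rewrite !mxE.
    have -> : F x i 0 - G x i 0 - (F s i 0 - G s i 0) =
      (F x i 0 - F s i 0) - (G x i 0 - G s i 0) by ring.
    apply: le_trans (cmodB _ _) _; rewrite mulrDl.
    by apply: lerD; [exact: Flip|exact: Glip].
  - move=> z qz; rewrite lt_min => /andP[zeta /near_rho zrho].
    under eq_bigr do rewrite !mxE mulrBr.
    by rewrite sumrB FG // subrr.
exists (fun s => F0 s s); split; first split.
- move=> s /ballE0 srho; have [eps [Lam [eps0 F_an Flip Frep]]] := hF0 s srho.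
  have m0 : 0 < Num.min eps (rho - cmod s) by rewrite lt_min eps0; lra.
  apply: (analytic_at_ext m0) F_an => x.
  rewrite lt_min => /andP[xeps /near_rho xrho].
  have [eps' [Lam' [eps'0 _ Flip' Frep']]] := hF0 x xrho.
  have near_s y : cmod (y - x) < eps - cmod (x - s) -> cmod (y - s) < eps.
    have -> : y - s = (y - x) + (x - s) by ring.
    by have := cmodD (y - x) (x - s); lra.
  have m'0 : 0 < Num.min eps' (eps - cmod (x - s)) by rewrite lt_min eps'0; lra.
  apply: (unique _ _ x _ Lam Lam' xrho m'0).
  + by move=> i y; rewrite lt_min => /andP[_ /near_s ys]; exact: Flip.
  + move=> i y; rewrite lt_min => /andP[yx _]; apply: Flip' => //.
    by rewrite subrr cmod0.
  + move=> z qz _; rewrite lt_min => /andP[zx /near_s zs].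
    by rewrite -Frep // -Frep'.
- move=> z /subE [qz zrho]; rewrite (repE (fun s => F0 s s)).
  have [eps [Lam [eps0 _ _ Frep]]] := hF0 _ zrho.
  by rewrite (Frep z qz) // subrr cmod0.
move=> G [G_an Grep] s /[dup] /ballE0 srho sball.
have [eps [Lam [eps0 _ Flip Frep]]] := hF0 s srho.
have [eta [LG [eta0 Glip]]] := analytic_lipschitz_at (G_an s sball).
have m0 : 0 < Num.min eta eps by rewrite lt_min eta0.
apply: (unique _ _ s _ LG Lam srho m0).
- by move=> i x; rewrite lt_min => /andP[xs _]; exact: Glip.
- move=> i x; rewrite lt_min => /andP[_ xs]; apply: Flip => //.
  by rewrite subrr cmod0.
- move=> z qz zrho; rewrite lt_min => /andP[_ zs].
  by rewrite -Frep // -repE -Grep //; apply/subE.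
Qed.
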